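(* Let $X=\mathbb{R}$ or $X=\mathbb{S}$, and let $f:\mathbb{R}\to\mathbb{R}$ be a differentiable function which does not change sign and such that $x=0$ is the only solution of $f(x)=0$. Given $u_0\in H^4(X)$, let $u\in C^0([0,T);H^4(X))\cap C^1([0,T);H^3(X))$ be the corresponding unique solution, with lifespan $T$, of the Cauchy problem $$u_t-u_{txx}+\partial_x f(u)=0,\quad t>0,\ x\in X,\qquad u(0,x)=u_0(x),\quad x\in X.$$ If $u$ is compactly supported (as a function on $[0,T)\times X$), then $u\equiv 0$ in $[0,T)\times X$.
   Context: $\mathbb{S}=\mathbb{R}/\mathbb{Z}$ is the circle (periodic problem), identified with $[0,1)$; $X=\mathbb{R}$ is the real problem. $H^s(X)$ is the usual $L^2$-based Sobolev space of real-valued functions. ''$f$ does not change sign'' means that either $f\ge 0$ on $\mathbb{R}$ or $f\le 0$ on $\mathbb{R}$. The lifespan $T\in(0,\infty]$ is the maximal time of existence of the solution. The Cauchy problem is equivalent to $u_t=-\partial_x\Lambda^{-2}f(u)$, $u(0)=u_0$, where $\Lambda^{-2}=(1-\partial_x^2)^{-1}$, i.e. $\Lambda^{-2}\phi=g\ast\phi$ with $g(x)=e^{-|x|}/2$ if $X=\mathbb{R}$ and $g(x)=\cosh(x-\lfloor x\rfloor-1/2)/(2\sinh(1/2))$ if $X=\mathbb{S}$. *)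

(* Defs.v *)
From HB Require Import structures.
From mathcomp Require Import all_boot all_order all_algebra.
From mathcomp Require Import all_classical all_reals all_analysis.

Set Implicit Arguments.
Unset Strict Implicit.
Unset Printing Implicit Defensive.

Import Order.TTheory GRing.Theory Num.Theory.
Import numFieldNormedType.Exports.

Local Open Scope classical_set_scope.
Local Open Scope ring_scope.

Inductive domain : Set := Line | Circle.

Section SobolevSpaces.
Variables (R : realType) (X : domain).
Implicit Types (u v phi : R -> R) (k j : nat).

(* Functions on the circle R/Z are represented by 1-periodic functions on R. *)
Definition fun_on u : Prop :=
  match X with Line => True | Circle => periodic u 1 end.

(* A closed subset of R mapping onto X: for the circle, [0, 1] instead of
   [0, 1), so that it is compact; the extra endpoint is Lebesgue-negligible. *)
Definition cell : set R :=
  match X with Line => setT | Circle => `[0, 1]%classic end.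

Lemma measurable_cell : measurable cell.
Proof. by rewrite /cell; case: X => //; exact: measurable_itv. Qed.

Definition muX : {measure set measurableTypeR R -> \bar R} :=
  mrestr lebesgue_measure measurable_cell.

Definition L2 u : Prop := fun_on u /\ u \in Lfun muX 2%:E.

Definition L1loc u : Prop :=
  fun_on u /\ locally_integrable (setT : set R) u.

(* Smooth functions on X whose support is compact in X; for X = Circle the
   support condition is automatic. *)
Definition test_function phi : Prop :=
  [/\ fun_on phi,
      forall n x, derivable (phi^`(n))%classic x 1
    & compact (closure [set x | phi x != 0] `&` cell)].

Definition weak_derivative j u v : Prop :=
  [/\ L1loc u, L1loc v &
      forall phi, test_function phi ->
        \int[muX]_x (u x * (phi^`(j))%classic x) =
        (-1) ^+ j * \int[muX]_x (v x * phi x)].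

Definition Sobolev k u : Prop :=
  L2 u /\ forall j, (j <= k)%N -> exists2 v, weak_derivative j u v & L2 v.

(* Some representative of the j-th weak derivative (junk if there is none). *)
Definition wderiv j u : R -> R :=
  xget (fun=> 0) [set v | weak_derivative j u v].

(* Meaningful only for u such that [Sobolev k u]. *)
Definition Sobolev_norm k u : R :=
  Num.sqrt (\sum_(j < k.+1)
    fine ('N[muX]_(2%:E)[EFin \o wderiv j u])%E ^+ 2).

(* C^0(J; H^k(X)) *)
Definition Sobolev_continuous k (J : set R) (u : R -> R -> R) : Prop :=
  forall t0, J t0 -> Sobolev k (u t0) /\
    Sobolev_norm k (fun x => u t x - u t0 x) @[t --> within J (nbhs t0)] --> 0.

(* v is the time derivative of u in H^k(X), one-sided at endpoints in J. *)
Definition Sobolev_derivative k (J : set R) (u v : R -> R -> R) : Prop :=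
  forall t0, J t0 ->
    Sobolev_norm k (fun x => (t - t0)^-1 * (u t x - u t0 x) - v t0 x)
      @[t --> within J t0^'] --> 0.

End SobolevSpaces.

Section Equation.
Variables (R : realType) (X : domain).

Definition before (T : \bar R) : set R := [set t | 0 <= t /\ (t%:E < T)%E].

(* u is in C^0([0,T); H^4) and C^1([0,T); H^3) with time derivative ut; each
   u t is the continuous representative of its class in H^4. *)
Definition solution_with (f : R -> R) (u0 : R -> R) (T : \bar R)
    (u ut : R -> R -> R) : Prop :=
  [/\ Sobolev_continuous X 4 (before T) u,
      Sobolev_continuous X 3 (before T) ut,
      Sobolev_derivative X 3 (before T) u ut,
      forall t, before T t -> continuous (u t)
    & (\forall x \ae muX R X, u 0 x = u0 x) /\
      forall t : R, 0 < t -> before T t -> exists utxx fx : R -> R,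
        [/\ weak_derivative X 2 (ut t) utxx,
            weak_derivative X 1 (fun x => f (u t x)) fx
          & \forall x \ae muX R X, ut t x - utxx x + fx x = 0]].

Definition solution f u0 T u : Prop := exists ut, solution_with f u0 T u ut.

(* T is the maximal time of existence of the solution u. *)
Definition lifespan f u0 (T : \bar R) (u : R -> R -> R) : Prop :=
  solution f u0 T u /\
  ~ exists (T' : \bar R) (v : R -> R -> R),
      [/\ (T < T')%E, solution f u0 T' v
        & forall t x, before T t -> v t x = u t x].

(* The support of u in [0,T) x R; in the periodic case it is the preimage of
   the support in [0,T) x R/Z, because R -> R/Z is an open map. *)
Definition support_before (T : \bar R) (u : R -> R -> R) : set (R * R) :=
  closure [set p | before T p.1 /\ u p.1 p.2 != 0] `&` [set p | before T p.1].

(* Compactness of the support in [0,T) x X: in the periodic case,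
   [0,T) x [0,1] -> [0,T) x R/Z is a proper surjection, so a closed set of the
   target is compact iff its preimage is. *)
Definition compactly_supported (T : \bar R) (u : R -> R -> R) : Prop :=
  compact (support_before T u `&` [set p | cell X p.2]).

End Equation.

(* Main.v *)
Require Import Defs.
From mathcomp Require Import all_boot all_order all_algebra.
From mathcomp Require Import all_classical all_reals all_analysis.
From mathcomp Require Import measurable_realfun.
From mathcomp Require Import ring lra zify.
Import Order.TTheory GRing.Theory Num.Theory.
Import numFieldNormedType.Exports.
Set Implicit Arguments.
Unset Strict Implicit.
Unset Printing Implicit Defensive.
Local Open Scope classical_set_scope.
Local Open Scope ring_scope.

(* Compactness of the support in [0, T) x X makes u vanish identically from
   some time on, and the solution is then propagated backwards in time. Testing
   the equation against phi - phi'' gives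
     d/dt \int u(t) (phi - phi'') = \int f(u(t)) phi'.
   Solving phi - phi'' = psi for psi an approximate delta, with phi and phi'
   bounded by a constant times \int psi, turns this into
     sup |u(s)| <= C (t - s) sup_[s, t] sup |f(u)|   whenever u(t) = 0.
   As f is differentiable at 0 and f 0 = 0, |f y| <= L |y| for small y, so a
   Gronwall argument shows that u vanishes on a left neighbourhood of every
   time t > 0 at which it vanishes. The same duality bound gives the embedding
   of H^1 into the bounded functions, hence the continuity of u in time for the
   sup norm. *)

(* In ring_scope these notations denote formal derivatives of polynomials. *)
Local Notation "f ^` ()" := (derive1 f) : ring_scope.
Local Notation "f ^` ( n )" := (derive1n n f) : ring_scope.

(** * Smooth functions and bump functions *)

(** Derivatives are weak and the pairing with phi - phi'' needs a genuine test function, hence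
    duality rather than convolution with the Green function. On the line, the solution of phi -
    phi'' = psi built here need not even decay, so it is multiplied by a cutoff equal to 1 near
    [-r, r]. The equation then survives on [-r, r] only, which is enough because every [u t]
    vanishes beyond r: this is where compactness in space enters, and why the duality constant
    depends on r and not on psi. The size of psi is measured by its integral, since an approximate
    delta has bounded mass but unbounded sup; solving two first-order equations in a row turns that
    mass into sup bounds on phi and phi'. As the equation is imposed for t > 0 only, the backward
    propagation runs through positive times, and time 0 is reached by continuity. *)

Section Smooth.
Variable R : realType.
Implicit Types (f g : R -> R) (n : nat) (x : R).

(** Order [n] means [n.+1] times differentiable. Counting the order lets closure under products,
    composition and inverses go by induction on [n]: a derivative formula involves the functions
    themselves only at the lower order, where [smooth_uptoW] supplies them. *)
Inductive smooth_upto : nat -> (R -> R) -> Prop :=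
| SmoothUpto0 f : (forall x, derivable f x 1) -> smooth_upto 0 f
| SmoothUptoS n f : (forall x, derivable f x 1) -> smooth_upto n f^`() ->
    smooth_upto n.+1 f.

Variant smooth f : Prop := Smooth of (forall n x, derivable (f^`(n)) x 1).

Lemma smooth_upto0 n f x : smooth_upto n f -> derivable f x 1.
Proof. by case. Qed.
Arguments smooth_upto0 [n f] x _.

Lemma smooth_uptoE n f : smooth_upto n.+1 f -> smooth_upto n f^`().
Proof.
move=> h; inversion h as [|m g _ hg E1 E2]; exact: hg.
Qed.

Lemma smooth_uptoW n f : smooth_upto n.+1 f -> smooth_upto n f.
Proof.
elim: n f => [|n IH] f h.
  by constructor => x; exact: (smooth_upto0 x h).
constructor; first by move=> x; exact: (smooth_upto0 x h).
exact: (IH _ (smooth_uptoE h)).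
Qed.

Lemma smooth_uptoP f : (forall n, smooth_upto n f) <-> smooth f.
Proof.
split=> [h|[+] n].
  constructor=> n; elim: n f h => [|n IH] f h x; first exact: (smooth_upto0 x (h 0%N)).
  by rewrite derive1Sn; apply: IH => m; exact: (smooth_uptoE (h m.+1)).
elim: n f => [|n IH] f h; constructor; [exact: (h 0%N)..|].
by apply: IH => m x; rewrite -derive1Sn; exact: h.
Qed.

Lemma is_derive1E f x d : is_derive x 1 f d -> f^`() x = d.
Proof. by move=> h; rewrite derive1E derive_val. Qed.

Lemma is_derive1P f x : derivable f x 1 -> is_derive x 1 f (f^`() x).
Proof. by move=> h; rewrite derive1E; exact: derivableP. Qed.

Lemma derive1_eq f (df : R -> R) :
  (forall x, is_derive x 1 f (df x)) -> f^`() = df.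
Proof. by move=> h; apply/funext => x; exact: is_derive1E. Qed.

Lemma smooth_uptoS n f (df : R -> R) :
  (forall x, is_derive x 1 f (df x)) -> smooth_upto n df -> smooth_upto n.+1 f.
Proof.
by move=> h hdf; constructor; [move=> x; case: (h x)|rewrite (derive1_eq h)].
Qed.

Lemma smooth_upto_cst n (c : R) : smooth_upto n (cst c).
Proof.
elim: n c => [|n IH] c; first by constructor => x; exact: derivable_cst.
exact: (smooth_uptoS (is_derive_cst c ^~ 1) (IH 0)).
Qed.

Lemma smooth_upto_id n : smooth_upto n (@id R).
Proof.
case: n => [|n]; first by constructor => x; exact: derivable_id.
have d (x : R) : is_derive x 1 id (cst 1 x) by exact: is_derive_id.
exact: (smooth_uptoS d (smooth_upto_cst n 1)).
Qed.

Lemma smooth_uptoD n f g : smooth_upto n f -> smooth_upto n g ->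
  smooth_upto n (fun x => f x + g x).
Proof.
have d (h k : R -> R) : (forall x, derivable h x 1) -> (forall x, derivable k x 1) ->
    forall x, is_derive x 1 (fun x => h x + k x) (h^`() x + k^`() x).
  move=> dh dk x; have A := is_derive1P (dh x); have B := is_derive1P (dk x).
  exact: is_deriveD.
elim: n f g => [|n IH] f g hf hg.
  constructor=> x; have [] // := d f g _ _ x => y.
    exact: (smooth_upto0 y hf).
  exact: (smooth_upto0 y hg).
apply: (smooth_uptoS (d f g _ _)) => [x|x|].
- exact: (smooth_upto0 x hf).
- exact: (smooth_upto0 x hg).
- exact: (IH _ _ (smooth_uptoE hf) (smooth_uptoE hg)).
Qed.

Lemma smooth_uptoM n f g : smooth_upto n f -> smooth_upto n g ->
  smooth_upto n (fun x => f x * g x).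
Proof.
have d (h k : R -> R) : (forall x, derivable h x 1) -> (forall x, derivable k x 1) ->
    forall x, is_derive x 1 (fun x => h x * k x) (h x * k^`() x + k x * h^`() x).
  move=> dh dk x; have A := is_derive1P (dh x); have B := is_derive1P (dk x).
  exact: is_deriveM.
elim: n f g => [|n IH] f g hf hg.
  constructor=> x; have [] // := d f g _ _ x => y.
    exact: (smooth_upto0 y hf).
  exact: (smooth_upto0 y hg).
apply: (smooth_uptoS (d f g _ _)) => [x|x|].
- exact: (smooth_upto0 x hf).
- exact: (smooth_upto0 x hg).
- apply: smooth_uptoD.
    exact: (IH _ _ (smooth_uptoW hf) (smooth_uptoE hg)).
  exact: (IH _ _ (smooth_uptoW hg) (smooth_uptoE hf)).
Qed.

Lemma smooth_upto_comp n f g : smooth_upto n f -> smooth_upto n g ->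
  smooth_upto n (f \o g).
Proof.
have d (h k : R -> R) : (forall x, derivable h x 1) ->
    (forall x, derivable k x 1) ->
    forall x, is_derive x 1 (h \o k) ((h^`() \o k) x * k^`() x).
  move=> dh dk x; have A := is_derive1P (dk x).
  have B := is_derive1P (dh (k x)).
  exact: is_derive1_comp.
elim: n f g => [|n IH] f g hf hg.
  constructor=> x; have [] // := d f g _ _ x => y.
    exact: (smooth_upto0 y hf).
  exact: (smooth_upto0 y hg).
apply: (smooth_uptoS (d f g _ _)) => [x|x|].
- exact: (smooth_upto0 x hf).
- exact: (smooth_upto0 x hg).
- apply: smooth_uptoM; last exact: (smooth_uptoE hg).
  exact: (IH _ _ (smooth_uptoE hf) (smooth_uptoW hg)).
Qed.

Lemma smooth_uptoV n f : (forall x, f x != 0) -> smooth_upto n f ->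
  smooth_upto n (fun x => (f x)^-1).
Proof.
move=> f0 hf.
(* The derivative is written as a product containing the inverse itself, so that the induction
   hypothesis and [smooth_uptoM] apply to it. *)
have d x : is_derive x 1 (fun x => (f x)^-1)
    (-1 * ((f x)^-1 * (f x)^-1 * f^`() x)).
  have A := is_derive1P (smooth_upto0 x hf).
  apply: is_derive_eq.
  by rewrite mulN1r scaleNr -exprVn expr2.
elim: n hf => [|n IH] hf; first by constructor => x; case: (d x).
apply: (smooth_uptoS d).
have IH' := IH (smooth_uptoW hf).
apply: smooth_uptoM; first exact: smooth_upto_cst.
by apply: smooth_uptoM; [exact: smooth_uptoM|exact: smooth_uptoE].
Qed.

Lemma smooth_cst (c : R) : smooth (cst c).
Proof. by apply/smooth_uptoP => n; exact: smooth_upto_cst. Qed.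

Lemma smooth_id : smooth id.
Proof. by apply/smooth_uptoP => n; exact: smooth_upto_id. Qed.

Lemma smoothD f g : smooth f -> smooth g -> smooth (fun x => f x + g x).
Proof.
move=> /smooth_uptoP hf /smooth_uptoP hg; apply/smooth_uptoP => n.
exact: smooth_uptoD.
Qed.

Lemma smoothM f g : smooth f -> smooth g -> smooth (fun x => f x * g x).
Proof.
move=> /smooth_uptoP hf /smooth_uptoP hg; apply/smooth_uptoP => n.
exact: smooth_uptoM.
Qed.

Lemma smooth_comp f g : smooth f -> smooth g -> smooth (f \o g).
Proof.
move=> /smooth_uptoP hf /smooth_uptoP hg; apply/smooth_uptoP => n.
exact: smooth_upto_comp.
Qed.

Lemma smoothV f : (forall x, f x != 0) -> smooth f -> smooth (fun x => (f x)^-1).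
Proof. by move=> f0 /smooth_uptoP hf; apply/smooth_uptoP => n; exact: smooth_uptoV. Qed.

Lemma smooth_derivable f x : smooth f -> derivable f x 1.
Proof. by case=> /(_ 0%N). Qed.

Lemma smooth_is_derive f x : smooth f -> is_derive x 1 f (f^`() x).
Proof. by move=> /smooth_derivable/is_derive1P. Qed.

Lemma smooth_derive1n f n : smooth f -> smooth (f^`(n)).
Proof. by case=> hf; constructor=> m x; rewrite /derive1n -iterD; exact: hf. Qed.

Lemma smooth_derive1 f : smooth f -> smooth (f^`()).
Proof. by move=> /(@smooth_derive1n _ 1). Qed.

Lemma smooth_continuous f : smooth f -> continuous f.
Proof.
move=> hf x; apply: differentiable_continuous; apply/derivable1_diffP.
exact: smooth_derivable.
Qed.

Lemma smoothS f : (forall x, derivable f x 1) -> smooth f^`() -> smooth f.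
Proof. by move=> df [hf]; constructor=> -[|n] x; [exact: df|rewrite derive1Sn]. Qed.

Lemma smooth_expR : smooth expR.
Proof.
suff E n : expR^`(n) = expR :> (R -> R).
  by constructor=> n x; rewrite E; exact: derivable_expR.
elim: n => [//|n IH]; rewrite derive1nS IH.
by apply: derive1_eq => x; exact: is_derive_expR.
Qed.

Lemma smooth_cos : smooth cos.
Proof.
suff E n : smooth_upto n (@cos R) /\ smooth_upto n (@sin R).
  by apply/smooth_uptoP => n; have [] := E n.
have dcos (x : R) : is_derive x 1 cos (-1 * sin x).
  by rewrite mulN1r; exact: is_derive_cos.
elim: n => [|n [IHc IHs]].
  by split; constructor => x; [exact: derivable_cos|exact: derivable_sin].
split; last exact: (smooth_uptoS (@is_derive_sin R)).
by apply: (smooth_uptoS dcos); apply: smooth_uptoM => //; exact: smooth_upto_cst.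
Qed.

Lemma derive1n_near_eq f g n x : (\near x, f x = g x) -> f^`(n) x = g^`(n) x.
Proof.
move=> fg; suff : \near x, f^`(n) x = g^`(n) x by exact: nbhs_singleton.
elim: n => [//|n IH]; rewrite !derive1nS.
have /near_join := IH; apply: filterS => y fgy.
by rewrite !derive1E (near_eq_derive (1 : R) fgy).
Qed.

Lemma derive1n_near0 f n x : (\near x, f x = 0) -> f^`(n) x = 0.
Proof.
move=> f0; rewrite (@derive1n_near_eq _ (cst 0)) //.
elim: n x {f f0} => [//|n IH] x.
by rewrite derive1nS (_ : (cst 0)^`(n) = cst 0) ?derive1_cst //; apply/funext.
Qed.

End Smooth.

Section Bumps.
Variable R : realType.
Implicit Types (s x y e : R) (k n : nat).

(** The difference quotient at 0 is at most C |h| in absolute value. This settles the point 0 for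
    the flat functions below. *)
Lemma is_derive0_quadratic (f : R -> R) (C : R) :
  (forall s, `|f s| <= C * s ^+ 2) -> is_derive (0 : R) 1 f 0.
Proof.
move=> fC.
have f0 : f 0 = 0 by apply/eqP; rewrite -normr_le0; have := fC 0; rewrite expr0n mulr0.
have C0 : 0 <= C by have := fC 1; rewrite expr1n mulr1; apply: le_trans.
suff L : h^-1 *: ((f \o shift 0) (h *: (1 : R)) - f 0) @[h --> 0^'] --> (0 : R).
  by apply: DeriveDef; [apply/cvg_ex; exists 0|exact/cvg_lim].
apply/cvgr0Pnorm_le => e e0; near=> h.
have h0 : h != 0 by near: h; exact: nbhs_dnbhs_neq.
rewrite /= /shift /= addr0 f0 subr0 /GRing.scale /= mulr1 normrM normfV.
rewrite ler_pdivrMl ?normr_gt0 //.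
apply: le_trans (fC h) _.
rewrite -real_normK ?num_real // expr2 mulrCA ler_wpM2l //.
have : `|h| <= e / (C + 1).
  near: h; apply: dnbhs0_le; rewrite divr_gt0 //; lra.
rewrite ler_pdivlMr; last lra.
by move=> ?; have := normr_ge0 h; lra.
Unshelve. all: by end_near. Qed.

(* [flat 0] is the classical flat function; the factors s^-k make the family
   stable under differentiation. *)
Definition flat k s : R := if 0 < s then s^-1 ^+ k * expR (- s^-1) else 0.

(** With t = 1/s, e^t is the (k+2)-th power of e^(t/(k+2)), hence at least (t/(k+2))^(k+2); this
    gives the constant. The two powers beyond k leave the factor s^2, so every member of the family
    has derivative 0 at 0. *)
Lemma flat_quadratic k s : `|flat k s| <= (k.+2)%:R ^+ k.+2 * s ^+ 2.
Proof.
rewrite /flat; case: ifPn => [s0|_]; last first.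
  by rewrite normr0 mulr_ge0 ?sqr_ge0 // exprn_ge0.
have K0 : 0 < k.+2%:R :> R by rewrite ltr0n.
rewrite ger0_norm; last by rewrite mulr_ge0 ?expR_ge0 // exprn_ge0 // invr_ge0 ltW.
have E : (s^-1 / k.+2%:R) ^+ k.+2 <= expR (s^-1).
  have -> : s^-1 = k.+2%:R * (s^-1 / k.+2%:R) by rewrite mulrCA divff ?mulr1 // gt_eqF.
  rewrite expRM_natl mulrCA divff ?mulr1 ?gt_eqF //.
  rewrite lerXn2r ?nnegrE ?expR_ge0 ?divr_ge0 ?invr_ge0 ?ltW //.
  by apply: lt_le_trans (expR_ge1Dx _); rewrite ltrDr.
rewrite expRN ler_pdivrMr ?expR_gt0 //.
have -> : s^-1 ^+ k = k.+2%:R ^+ k.+2 * s ^+ 2 * (s^-1 / k.+2%:R) ^+ k.+2.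
  rewrite exprMn exprVn [s^-1 ^+ k.+2]exprS [s^-1 ^+ k.+1]exprS.
  rewrite [k.+2%:R^-1 ^+ _]exprVn.
  have : k.+2%:R ^+ k.+2 != 0 :> R by rewrite expf_neq0 // gt_eqF.
  have : s ^+ k != 0 by rewrite expf_neq0 // gt_eqF.
  rewrite !exprVn; move: (k.+2%:R ^+ k.+2) (s ^+ k) => b c c0 b0.
  by field; rewrite b0 c0 gt_eqF.
by rewrite ler_wpM2l // mulr_ge0 ?sqr_ge0 // exprn_ge0.
Qed.

Lemma is_derive_flat k s :
  is_derive s 1 (flat k) (flat k.+2 s + - k%:R * flat k.+1 s).
Proof.
have [s0|s0|->] := ltgtP s 0.
- have sF : (0 < s) = false by apply/negbTE; rewrite -leNgt ltW.
  rewrite /flat sF mulr0 addr0.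
  apply: (@near_eq_is_derive _ _ _ (cst 0)).
  near=> y; rewrite ifF //; apply/negbTE; rewrite -leNgt ltW //.
  by near: y; exact: lt_nbhsl.
- rewrite /flat !s0.
  apply: (@near_eq_is_derive _ _ _ (fun y => y^-1 ^+ k * expR (- y^-1))).
    near=> y; rewrite ifT //.
    by near: y; exact: lt_nbhsr.
  have sn0 : s != 0 by rewrite gt_eqF.
  have dV : is_derive s 1 (fun y => y^-1) (- s^-1 ^+ 2).
    by have := is_deriveV sn0 (is_derive_id s 1); rewrite /GRing.scale /= mulr1 exprVn.
  have dE : is_derive s 1 (fun y => expR (- y^-1)) (expR (- s^-1) * s^-1 ^+ 2).
    have dN : is_derive s 1 (fun y => - y^-1) (s^-1 ^+ 2).
      by apply: is_derive_eq; rewrite opprK.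
    exact: (is_derive1_comp (is_derive_expR _) dN).
  have dX : is_derive s 1 (fun y => y^-1 ^+ k) (- k%:R * s^-1 ^+ k.+1).
    have dP : is_derive s^-1 1 (fun z => z ^+ k) (k%:R * s^-1 ^+ k.-1).
      by have := is_derive1P (@exprn_derivable _ k s^-1 1); rewrite exp_derive1.
    have := is_derive1_comp dP dV.
    have -> : k%:R * s^-1 ^+ k.-1 * - s^-1 ^+ 2 = - k%:R * s^-1 ^+ k.+1.
      case: (k) => [|m] /=; first by rewrite oppr0 !mul0r.
      by rewrite mulrN mulNr -mulrA -exprD addn2.
    exact.
  have D := is_deriveM dX dE.
  apply: (is_derive_eq D); rewrite /GRing.scale /= !exprS; ring.
- rewrite /flat ltxx mulr0 addr0; exact: is_derive0_quadratic (flat_quadratic k).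
Unshelve. all: by end_near. Qed.

Lemma smooth_flat k : smooth (flat k).
Proof.
apply/smooth_uptoP => n; elim: n k => [|n IH] k.
  by constructor => s; case: (is_derive_flat k s).
apply: (smooth_uptoS (is_derive_flat k)); apply: smooth_uptoD; first exact: IH.
by apply: smooth_uptoM; [exact: smooth_upto_cst|exact: IH].
Qed.

Lemma flat_gt0 s : (0 < flat 0 s) = (0 < s).
Proof. by rewrite /flat; case: ifPn => //; rewrite ?ltxx // mul1r expR_gt0. Qed.

Lemma flat_ge0 s : 0 <= flat 0 s.
Proof. by rewrite /flat; case: ifPn => // _; rewrite mul1r expR_ge0. Qed.

Lemma periodic_int (f : R -> R) (m : int) x :
  periodic f 1 -> f (x + m%:~R) = f x.
Proof.
move=> fp; case: m => n; first exact: (periodicn fp).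
by rewrite NegzE -[in RHS](subrK (n.+1)%:R x) mulrNz; symmetry; exact: (periodicn fp).
Qed.

Definition near_mod (X : domain) x0 e x : Prop :=
  match X with
  | Line => `|x - x0| < e
  | Circle => exists m : int, `|x - x0 - m%:~R| < e
  end.

Lemma cos_2pi_periodic : periodic (fun y : R => cos (2 * pi * y)) 1.
Proof.
by move=> y; rewrite mulrDr mulr1 mulr_natl; exact: cosD2pi.
Qed.

(** The cosine of 2 pi y depends only on the distance from y to the nearest integer, and decreases
    in that distance on [0, 1/2]. *)
Lemma lt_cos_2pi e y : 0 < e -> e < 2^-1 ->
  cos (2 * pi * e) < cos (2 * pi * y) <-> exists m : int, `|y - m%:~R| < e.
Proof.
move=> e0 e1.
have pi0 := pi_gt0 R.
have K (m : int) : cos (2 * pi * y) = cos (2 * pi * `|y - m%:~R|).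
  have -> : 2 * pi * `|y - m%:~R| = `|2 * pi * (y - m%:~R)|.
    by rewrite normrM ger0_norm //; lra.
  rewrite cos_norm -mulrNz.
  by rewrite (periodic_int _ _ cos_2pi_periodic).
have lt z : 0 <= z -> z <= 2^-1 -> (cos (2 * pi * e) < cos (2 * pi * z)) = (z < e).
  move=> z0 z1; rewrite ltr_cos ?in_itv /=; [|apply/andP; split; nra..].
  by rewrite ltr_pM2l //; lra.
split=> [|[m ym]]; last by rewrite (K m) lt //; lra.
pose m := Num.floor (y + 2^-1).
have /andP[m1 m2] := floor_itv (y + 2^-1).
have ym : `|y - m%:~R| <= 2^-1.
  move: m1 m2; rewrite -/m intrD ler_norml => ? ?; apply/andP; split; lra.
by rewrite (K m) lt //; exists m.
Qed.

Lemma smooth_affine (a b : R) : smooth (fun x => a * (x - b)).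
Proof.
exact: (smoothM (smooth_cst a) (smoothD (smooth_id R) (smooth_cst (- b)))).
Qed.

(** [flat 0] is composed with a smooth function that is positive exactly on the ball: e^2 - (x -
    x0)^2 on the line, and cos (2 pi (x - x0)) - cos (2 pi e) on the circle, which is periodic by
    itself. *)
Lemma smooth_bump (X : domain) x0 e : 0 < e -> e < 2^-1 ->
  exists psi : R -> R, [/\ smooth psi, fun_on X psi, forall x, 0 <= psi x &
    forall x, 0 < psi x <-> near_mod X x0 e x].
Proof.
move=> e0 e1; case: X => /=.
- exists (fun x => flat 0 (- (1 * (x - x0) * (1 * (x - x0))) + e ^+ 2)).
  split=> // [|x|x]; last first.
  + rewrite flat_gt0 mul1r -expr2 addrC subr_gt0 -[(x - x0) ^+ 2]real_normK ?num_real //.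
    by rewrite ltr_pXn2r ?nnegrE // ltW.
  + exact: flat_ge0.
  apply: (smooth_comp (smooth_flat 0)).
  apply: smoothD (smooth_cst _).
  have H := smooth_affine 1 x0.
  have H2 := smoothM (smooth_cst (-1)) (smoothM H H).
  by under eq_fun do rewrite -mulN1r.
- exists (fun x => flat 0 (cos (2 * pi * (x - x0)) + - cos (2 * pi * e))).
  split=> [|x|x|x]; last first.
  + by rewrite flat_gt0 subr_gt0; exact: lt_cos_2pi.
  + exact: flat_ge0.
  + by rewrite addrAC cos_2pi_periodic.
  apply: (smooth_comp (smooth_flat 0)).
  apply: smoothD (smooth_cst _).
  exact: (smooth_comp (smooth_cos R) (smooth_affine _ _)).
Qed.

End Bumps.

(** * Integration against muX and test functions *)

Section MuX.
Variables (R : realType) (X : domain).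
Local Notation leb := (@lebesgue_measure R).
Local Notation mu := (muX R X).
Local Notation cell := (@cell R X).
Implicit Types (K : set R).

Lemma muXE (A : set R) : mu A = leb (A `&` cell).
Proof. by []. Qed.

(** The complement of the cell is null for [muX]. Nonnegative functions are treated first and the
    result is applied to the positive and negative parts, because [f] is only assumed measurable. *)
Lemma integral_muX (f : R -> \bar R) : measurable_fun setT f ->
  (\int[mu]_x f x = \int[leb]_(x in cell) f x)%E.
Proof.
move=> mf.
have mC : measurable cell := @measurable_cell R X.
have mC' : measurable (~` cell) := measurableC mC.
have ge0 (g : R -> \bar R) : measurable_fun setT g -> (forall x, 0 <= g x)%E ->
    (\int[mu]_x g x = \int[mu]_(x in cell) g x)%E.
  move=> mg g0; rewrite -(setvU cell) setUC ge0_integral_setU //.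
  - rewrite [X in (_ + X)%E](_ : _ = 0)%E ?adde0 //.
    apply: null_set_integral => //; first exact: measurable_funTS.
    by rewrite muXE setICl measure0.
  - exact: measurable_funTS.
  - by rewrite /disj_set setICr.
rewrite [LHS]integralE ge0 ?ge0 //; last exact: measurable_funepos.
- rewrite -integralE; apply: eq_measure_integral => A mA Ac.
  by rewrite muXE setIidl.
- exact: measurable_funeneg.
Qed.

Lemma integrable_muX (f : R -> \bar R) : measurable_fun setT f ->
  leb.-integrable cell f -> mu.-integrable setT f.
Proof.
move=> mf /integrableP[_ fi]; apply/integrableP; split => //.
by rewrite integral_muX //; exact: measurableT_comp.
Qed.

Lemma integral_muX_supp K (g : R -> R) : measurable K -> K `<=` cell ->
  measurable_fun setT g -> leb.-integrable K (EFin \o g) ->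
  (forall x, cell x -> ~ K x -> g x = 0) ->
  mu.-integrable setT (EFin \o g) /\
  \int[mu]_x g x = \int[leb]_(x in K) g x.
Proof.
move=> mK KC mg gi g0.
have mC : measurable cell := @measurable_cell R X.
have gK : {in cell, (EFin \o g) \_ K =1 (EFin \o g)}.
  move=> x /set_mem cx; rewrite patchE; case: ifPn => // /negP xK.
  by rewrite /= g0 // => Kx; apply: xK; exact: mem_set.
have gC : leb.-integrable cell (EFin \o g).
  have h : leb.-integrable cell ((EFin \o g) \_ K).
    apply/integrable_restrict => //.
    by rewrite setIidr.
  apply: (@eq_integrable _ _ _ leb cell mC _ _ gK h).
have mg' : measurable_fun setT (EFin \o g) by exact/measurable_EFinP.
split; first exact: integrable_muX.
rewrite /Rintegral integral_muX //; congr fine.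
transitivity (\int[leb]_(x in cell) ((EFin \o g) \_ K) x)%E.
  by apply: eq_integral => x /gK ->.
by rewrite -integral_mkcondr setIidr.
Qed.

Lemma test_functionP (phi : R -> R) : smooth phi -> fun_on X phi ->
  (exists M, forall x, cell x -> M < `|x| -> phi x = 0) ->
  test_function X phi.
Proof.
move=> [sphi] pphi [M phi0]; split => //.
suff [a [b Kab]] : exists a b, closure [set x | phi x != 0] `&` cell `<=` `[a, b].
  apply: (subclosed_compact _ (@segment_compact _ a b)) => //.
  apply: closedI; first exact: closed_closure.
  rewrite /Defs.cell; case: (X); first exact: closedT.
  exact: interval_closed.
case: (X) phi0 => /= phi0; last by exists 0, 1 => x [].
exists (- M), M => x [+ _].
suff : closure [set x | phi x != 0] `<=` `[- M, M] by apply.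
have -> : `[- M, M]%classic = closure `[- M, M] by apply/closure_id/interval_closed.
apply: closure_subset => y /= /eqP y0; rewrite in_itv /= -ler_norml leNgt.
by apply/negP => My; apply: y0; exact: phi0.
Qed.

Lemma test_function_smooth (phi : R -> R) : test_function X phi -> smooth phi.
Proof. by case. Qed.

Lemma test_function_supp (phi : R -> R) : test_function X phi ->
  exists K, [/\ compact K, K `<=` cell &
    forall n x, cell x -> ~ K x -> phi^`(n) x = 0].
Proof.
move=> [_ _ cK]; exists (closure [set x | phi x != 0] `&` cell); split => //.
move=> n x cx Kx; apply: derive1n_near0.
have : nbhs x (~` closure [set x | phi x != 0]).
  apply: open_nbhs_nbhs; split; last by move=> h; apply: Kx.
  exact/closed_openC/closed_closure.
apply: filterS => y /= y0; apply/eqP; apply: contrapT => /negP h.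
by apply: y0; exact: (@subset_closure _ [set x | phi x != 0]).
Qed.

Lemma fun_on_derive1n (phi : R -> R) n : fun_on X phi -> fun_on X (phi^`(n)).
Proof.
rewrite /fun_on; case: (X) => // pphi; elim: n => [//|n IH] x.
have E : phi^`(n) \o shift (x + 1) = phi^`(n) \o shift x.
  by apply/funext => h /=; rewrite addrA IH.
by rewrite derive1nS !derive1E /derive E IH.
Qed.

Lemma test_function_derive1n (phi : R -> R) n :
  test_function X phi -> test_function X (phi^`(n)).
Proof.
move=> tphi; apply: test_functionP.
- exact/smooth_derive1n/test_function_smooth.
- by case: tphi => pphi _ _; exact: fun_on_derive1n.
- have [K [/compact_bounded[M [_ KM]] _ K0]] := test_function_supp tphi.
  exists (`|M| + 1) => x cx Mx; apply: K0 => // Kx.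
  have M1 : M < `|M| + 1 by rewrite ltr_pwDr // ler_norm.
  by have := KM _ M1 x Kx; rewrite /= leNgt Mx.
Qed.

Lemma compact_continuous_bounded K (f : R -> R) : compact K -> continuous f ->
  exists2 M : R, 0 <= M & forall x, K x -> `|f x| <= M.
Proof.
move=> cK cf.
have /compact_bounded[M [_ KM]] : compact (f @` K).
  by apply: continuous_compact => //; exact: continuous_subspaceT.
exists (`|M| + 1) => [|x Kx]; first by rewrite addr_ge0.
by apply: (KM (`|M| + 1)) => //; rewrite ltr_pwDr // ler_norm.
Qed.

(** [u] is integrable on compact sets only, but the derivative of [phi] is bounded on one of them
    and vanishes on the rest of the cell. *)
Lemma L1loc_integrable_mul u (phi : R -> R) n : L1loc X u -> test_function X phi ->
  mu.-integrable setT (EFin \o (fun x => u x * phi^`(n) x)).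
Proof.
move=> [_ [mf _ ui]] tphi.
have [K [cK KC K0]] := test_function_supp tphi.
have cphi : continuous (phi^`(n)).
  exact/smooth_continuous/smooth_derive1n/test_function_smooth.
have mK : measurable K by exact: compact_measurable.
have mphi := continuous_measurable_fun cphi.
have mup : measurable_fun setT (fun x => u x * phi^`(n) x).
  exact: measurable_funM.
apply: (integral_muX_supp mK KC mup _ _).1; last first.
  by move=> x cx Kx; rewrite K0 // mulr0.
have [M M0 KM] := compact_continuous_bounded cK cphi.
have uK : leb.-integrable K (EFin \o u).
  apply/integrableP; split; last by apply: ui.
  by apply/measurable_EFinP; exact: measurable_funTS.
have h := @integrableZr _ _ _ leb K mK M _ uK.
apply: (@le_integrable _ _ _ leb K mK _ _ _ _ h).
  by apply/measurable_EFinP; exact: measurable_funTS.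
move=> x Kx; rewrite /= lee_fin !normrM ler_wpM2l //.
by rewrite (ger0_norm M0) KM.
Qed.

End MuX.

(** * The fundamental lemma of the calculus of variations *)

Section CalculusOfVariations.
Variables (R : realType) (X : domain).
Local Notation leb := (@lebesgue_measure R).
Local Notation mu := (muX R X).
Local Notation cell := (@cell R X).

(** When e <= x <= 1 - e the ball does not wrap around the circle: among its integer translates,
    only the one with m = 0 meets [0, 1]. *)
Lemma near_mod_cell (x e y : R) : (X = Circle -> e <= x <= 1 - e) ->
  cell y -> near_mod X x e y -> ball x e y.
Proof.
rewrite /Defs.cell /near_mod; case: X => /= [_ _|/(_ erefl) /andP[ex x1]].
  by rewrite /ball /= distrC.
rewrite in_itv /= => /andP[y0 y1] [m]; rewrite ltr_norml => /andP[h1 h2].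
have m1 : m%:~R < 1%:~R :> R by lra.
have m0 : (- 1)%:~R < m%:~R :> R by rewrite mulrN1z; lra.
move: m0 m1; rewrite !ltr_int => m0 m1.
have mE : m = 0 by lia.
by rewrite mE in h1 h2; rewrite /ball /= distrC ltr_norml; lra.
Qed.

(* With psi > 0 exactly on the ball, the test functions psi / (psi + 1 / n) are
   bounded by 1 and converge to the indicator function of the ball. *)
Lemma integral_ball_eq0 (h : R -> R) (x e : R) :
  locally_integrable setT h ->
  (forall phi, test_function X phi -> \int[mu]_y (h y * phi y) = 0) ->
  0 < e -> e < 2^-1 -> (X = Circle -> e <= x <= 1 - e) ->
  (\int[leb]_(y in ball x e) (h y)%:E = 0)%E.
Proof.
move=> [mh _ hi] hphi e0 e1 xe.
have [psi [spsi ppsi psi0 psiE]] := smooth_bump X x e0 e1.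
pose phi n y := psi y * (psi y + n.+1%:R^-1)^-1.
have n0 n : 0 < n.+1%:R^-1 :> R by rewrite invr_gt0.
have phi01 n y : 0 <= phi n y <= 1.
  have P : 0 < psi y + n.+1%:R^-1 by rewrite ltr_wpDl.
  by rewrite /phi divr_ge0 ?(ltW P) //= ler_pdivrMr // mul1r lerDl ltW.
have psi_ball z : cell z -> ~ ball x e z -> psi z = 0.
  move=> cy yB; apply/eqP; rewrite eq_le psi0 andbT leNgt; apply/negP.
  by move=> /psiE /(near_mod_cell xe cy).
have sphi n : smooth (phi n).
  apply: smoothM => //; apply: smoothV.
    by move=> y; rewrite gt_eqF // ltr_wpDl.
  exact: (smoothD spsi (smooth_cst _)).
have tphi n : test_function X (phi n).
  apply: test_functionP => //.
    move: ppsi; rewrite /fun_on /phi; case: (X) => // ppsi y; by rewrite ppsi.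
  exists (`|x| + e) => y cy My; rewrite /phi psi_ball ?mul0r //.
  rewrite /ball /= ltr_distl => /andP[h1 h2].
  by move: My; case: (ger0P y) => ?; case: (ger0P x) => ?; lra.
have mB : measurable (ball x e) by exact: measurable_ball.
have hB : leb.-integrable (ball x e) (EFin \o h).
  apply: (@integrableS _ _ _ leb (closed_ball x e)) => //.
  - exact: measurable_closed_ball.
  - exact: subset_closed_ball.
  apply/integrableP; split; first by apply/measurable_EFinP; exact: measurable_funTS.
  by apply: hi => //; exact: closed_ballR_compact.
have BC : ball x e `<=` cell.
  rewrite /Defs.cell; case: (X) xe => // /(_ erefl) xe y.
  by rewrite /ball /= ltr_distl in_itv /=; lra.
have mhphi n : measurable_fun setT (fun y => h y * phi n y).
  apply: measurable_funM => //; apply: continuous_measurable_fun.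
  exact: smooth_continuous.
have dom n y : (`|(h y * phi n y)%:E| <= `|(h y)%:E|)%E.
  rewrite lee_fin normrM ler_piMr //.
  by have /andP[? ?] := phi01 n y; rewrite ger0_norm.
have hphiB n : leb.-integrable (ball x e) (EFin \o (fun y => h y * phi n y)).
  apply: (@le_integrable _ _ _ leb _ mB _ _ _ _ hB).
    by apply/measurable_EFinP; exact: (measurable_funTS (mhphi n)).
  by move=> y _; exact: dom.
have I0 n : (\int[leb]_(y in ball x e) (h y * phi n y)%:E = 0)%E.
  have hphi0 y : cell y -> ~ ball x e y -> h y * phi n y = 0.
    by move=> cy yB; rewrite /phi psi_ball // mul0r mulr0.
  have [_ E] := integral_muX_supp mB BC (mhphi n) (hphiB n) hphi0.
  rewrite -[LHS]fineK; last exact: (@integrable_fin_num _ _ _ leb _ mB _ (hphiB n)).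
  by move: E; rewrite hphi // /Rintegral => <-.
have [] := @dominated_convergence _ _ _ leb _ mB
  (fun n y => (h y * phi n y)%:E) (EFin \o h) (fun y => `|(h y)%:E|%E).
- by move=> n; apply/measurable_EFinP; exact: (measurable_funTS (mhphi n)).
- by apply/measurable_EFinP; exact: measurable_funTS.
- apply: aeW => y yB; apply/fine_cvgP; split; first by apply: nearW.
  have psiy : 0 < psi y.
    apply/psiE; move: yB; rewrite /ball /= distrC /near_mod; case: (X) => // yB.
    by exists 0; rewrite subr0.
  rewrite -[h y in X in _ --> X]mulr1; apply: cvgM; first exact: cvg_cst.
  rewrite -(divff (lt0r_neq0 psiy)); apply: cvgM; first exact: cvg_cst.
  apply: cvgV; first exact: lt0r_neq0.
  rewrite -[X in _ --> X]addr0; apply: cvgD; first exact: cvg_cst.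
  exact: cvg_harmonic.
- exact: (@integrable_abse _ _ _ leb).
- by apply: aeW => y n _; exact: dom.
move=> _ _ /cvg_lim <- //.
under eq_fun do rewrite I0.
by rewrite lim_cst.
Qed.

Lemma nicely_shrinking_harmonic_ball (x : R) :
  nicely_shrinking x (fun n => ball x (harmonic n : R)).
Proof.
split; first by move=> n; exact: measurable_ball.
have h0 n : 0 < harmonic n :> R by rewrite invr_gt0.
exists (1, fun n => PosNum (h0 n)); split => //=.
- exact: cvg_harmonic.
- by move=> n.
- by move=> n; rewrite mul1e.
Qed.

(** Small balls have mean value 0, so [h] vanishes at each of its Lebesgue points, and almost every
    point is one. *)
Lemma test_orthogonal_ae0 (h : R -> R) :
  locally_integrable setT h ->
  (forall phi, test_function X phi -> \int[mu]_y (h y * phi y) = 0) ->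
  \forall x \ae mu, h x = 0.
Proof.
move=> hL hphi.
(* The endpoints of the cell of the circle are left out, since every ball around them wraps; they
   form a null set. *)
pose D : set R := match X with Line => setT | Circle => `]0, 1[%classic end.
have D0 x : D x -> lebesgue_pt h x -> h x = 0.
  move=> Dx px.
  have := nice_lebesgue_differentiation nicely_shrinking_harmonic_ball hL px.
  suff : ((leb (ball x (harmonic n : R)))^-1 *
    \int[leb]_(y in ball x (harmonic n : R)) (h y)%:E)%E @[n --> \oo] --> 0%E.
    by move=> /(cvg_unique _) h1 /h1 - /(_ (@ereal_hausdorff _)) [].
  apply: (@cvg_trans _ (cst 0%E @ \oo)); last exact: cvg_cst.
  have DX : X = Circle -> 0 < x /\ 0 < 1 - x.
    by move=> XE; move: Dx; rewrite /D XE /= in_itv /= subr_gt0 => /andP.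
  have near_lt e : 0 < e -> \forall n \near \oo, (harmonic n : R) < e.
    by move=> e0; exact: (near_infty_natSinv_lt (PosNum e0)).
  have near_x : X = Circle -> \forall n \near \oo, harmonic n <= x <= 1 - harmonic n.
    move=> /DX[x0 x1]; near=> n; apply/andP; split.
      by apply: ltW; near: n; exact: near_lt.
    have : harmonic n < 1 - x by near: n; exact: near_lt.
    by move=> ?; lra.
  have near_x' : \forall n \near \oo, X = Circle -> harmonic n <= x <= 1 - harmonic n.
    by move: near_x; case: (X) => [_|/(_ erefl)]; [exact: nearW|apply: filterS].
  apply: near_eq_cvg; near=> n; rewrite /= integral_ball_eq0 ?mule0 //.
  - by near: n; apply: near_lt; rewrite invr_gt0.
  - by near: n.
have [N [mN N0 NP]] := lebesgue_differentiation hL.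
have mC := @measurable_cell R X.
exists (N `|` [set 0] `|` [set 1] `|` ~` cell); split.
- apply: measurableU; last exact: (measurableC mC).
  by apply: measurableU => //; apply: measurableU.
- have null A : measurable A -> leb A = 0%E -> mu A = 0%E.
    move=> mA A0; rewrite muXE; apply/eqP; rewrite eq_le measure_ge0 andbT -A0.
    by apply: le_measure; rewrite ?inE //; exact: (measurableI _ _ mA mC).
  have m1 : measurable (N `|` [set 0]) by exact: measurableU.
  apply: null_set_setU; [exact: measurableU|exact: measurableC| |].
    apply: null_set_setU => //; last by apply: null => //; rewrite lebesgue_measure_set1.
    apply: null_set_setU => //; first exact: null.
    by apply: null => //; rewrite lebesgue_measure_set1.
  by rewrite muXE setICl measure0.
move=> x /= hx.
have [cx|] := pselect (cell x); last by right.
left.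
have [->|x0] := eqVneq x 0; first by left; right.
have [->|x1] := eqVneq x 1; first by right.
left; left; apply: NP => /= px; apply: hx; apply: D0 => //.
move: cx; rewrite /D /Defs.cell; case: (X) => //=.
rewrite !in_itv /= => /andP[? ?].
by rewrite !lt_neqAle x1 eq_sym x0 /=; apply/andP.
Unshelve. all: by end_near. Qed.

End CalculusOfVariations.

(** * Weak derivatives and Sobolev norms *)

Section SobolevTheory.
Variables (R : realType) (X : domain).
Local Notation leb := (@lebesgue_measure R).
Local Notation mu := (muX R X).
Local Notation cell := (@cell R X).
Implicit Types (u v w phi : R -> R) (a : R) (j k : nat).

(** The shape a u + v, kept in the next lemmas, covers sums, differences and multiples at once. *)
Lemma fun_on_lin u v a : fun_on X u -> fun_on X v ->
  fun_on X (fun x => a * u x + v x).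
Proof. by rewrite /fun_on; case: (X) => // pu pv x; rewrite pu pv. Qed.

Lemma L1loc_lin u v a : L1loc X u -> L1loc X v -> L1loc X (fun x => a * u x + v x).
Proof.
move=> [pu [mu' _ iu]] [pv lv]; split; first exact: fun_on_lin.
apply: (@locally_integrableD _ _ (fun x => a * u x)) => //; split => //.
- exact: measurable_funM.
- exact: openT.
move=> K KT cK.
have mK : measurable K by exact: compact_measurable.
have uK : leb.-integrable K (EFin \o u).
  apply/integrableP; split; last by apply: iu.
  by apply/measurable_EFinP; exact: measurable_funTS.
by have /integrableP[] := @integrableZl _ _ _ leb K mK a _ uK.
Qed.

Lemma Rintegral_mul_lin u v phi a n : L1loc X u -> L1loc X v ->
  test_function X phi ->
  \int[mu]_x ((a * u x + v x) * phi^`(n) x) =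
  a * \int[mu]_x (u x * phi^`(n) x) + \int[mu]_x (v x * phi^`(n) x).
Proof.
move=> lu lv tphi.
have iu := L1loc_integrable_mul n lu tphi.
have iv := L1loc_integrable_mul n lv tphi.
rewrite -RintegralZl // -RintegralD //; last first.
  exact: (@integrableZl _ _ _ mu setT measurableT a _ iu).
by apply: eq_Rintegral => x _; rewrite mulrDl mulrA.
Qed.

Lemma weak_derivative_lin j u u' v v' a :
  weak_derivative X j u u' -> weak_derivative X j v v' ->
  weak_derivative X j (fun x => a * u x + v x) (fun x => a * u' x + v' x).
Proof.
move=> [lu lu' hu] [lv lv' hv]; split; [exact: L1loc_lin..|] => phi tphi.
rewrite Rintegral_mul_lin // hu // hv //.
by rewrite (@Rintegral_mul_lin _ _ phi _ 0) //; ring.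
Qed.

Lemma L2_lin u v a : L2 X u -> L2 X v -> L2 X (fun x => a * u x + v x).
Proof.
move=> [pu lu] [pv lv]; split; first exact: fun_on_lin.
have p1 : (1 <= 2%:E :> \bar R)%E by rewrite lee_fin ler1n.
have [_ hlin] := @Lfun_submod_closed _ _ R mu 2%:E p1.
exact: (hlin a u v lu lv).
Qed.

Lemma Sobolev_lin k u v a : Sobolev X k u -> Sobolev X k v ->
  Sobolev X k (fun x => a * u x + v x).
Proof.
move=> [lu hu] [lv hv]; split; first exact: L2_lin.
move=> j jk; have [u' wu lu'] := hu j jk; have [v' wv lv'] := hv j jk.
exists (fun x => a * u' x + v' x); first exact: weak_derivative_lin.
exact: L2_lin.
Qed.

Lemma SobolevB k u v : Sobolev X k u -> Sobolev X k v ->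
  Sobolev X k (fun x => u x - v x).
Proof.
move=> hu hv; have := Sobolev_lin (-1) hv hu.
by under eq_fun do rewrite mulN1r addrC.
Qed.

(** The difference of two candidates is orthogonal to all test functions, so the fundamental lemma
    applies. *)
Lemma weak_derivative_unique j u v w :
  weak_derivative X j u v -> weak_derivative X j u w ->
  \forall x \ae mu, v x = w x.
Proof.
move=> [_ lv hv] [_ lw hw].
have h0 : \forall x \ae mu, -1 * w x + v x = 0.
  apply: test_orthogonal_ae0; first by have [] := L1loc_lin (-1) lw lv.
  move=> phi tphi; rewrite (@Rintegral_mul_lin _ _ phi _ 0) //.
  have := hv _ tphi; rewrite hw // => /(congr1 (fun z => (-1) ^+ j * z)).
  by rewrite !mulrA -!exprMn mulrN1 opprK expr1n !mul1r => ->; ring.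
apply: (@filterS _ _ (ae_filter_ringOfSetsType mu)) h0 => x.
by rewrite mulN1r addrC => /subr0_eq.
Qed.

Lemma Lfun_ae_eq v w : measurable_fun setT v -> measurable_fun setT w ->
  (\forall x \ae mu, v x = w x) -> w \in Lfun mu 2%:E -> v \in Lfun mu 2%:E.
Proof.
move=> mv mw vw.
rewrite inE => /andP[_]; rewrite inE /= /finite_norm => Nw.
rewrite inE; apply/andP; split; first by rewrite inE.
rewrite inE /= /finite_norm; apply: le_lt_trans Nw.
rewrite le_eqVlt; apply/orP; left; apply/eqP; rewrite unlock; congr (_ `^ _)%E.
have m (f : R -> R) : measurable_fun setT f ->
    measurable_fun setT (fun x => `|(EFin \o f) x| `^ 2)%E.
  move=> mf; apply: (measurableT_comp (measurable_poweR _)) => //.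
  by apply: measurableT_comp => //; exact/measurable_EFinP.
apply: ge0_ae_eq_integral => //; [exact: m|exact: m| | |].
- by move=> x _; exact: poweR_ge0.
- by move=> x _; exact: poweR_ge0.
have [N [mN N0 h]] := vw; exists N; split=> // x /= hx.
by apply: h => /= vwx; apply: hx => _; rewrite vwx.
Qed.

(* [wderiv] is an arbitrary weak derivative: that it lies in L^2, so that
   [Sobolev_norm] is not a junk value, needs the uniqueness of weak derivatives. *)
Lemma wderivP k u j : Sobolev X k u -> (j <= k)%N ->
  weak_derivative X j u (wderiv X j u) /\ wderiv X j u \in Lfun mu 2%:E.
Proof.
move=> [_ hu] jk; have [v wv [_ lv]] := hu j jk.
have W : weak_derivative X j u (wderiv X j u).
  by rewrite /wderiv; exact: (xgetPex _ (ex_intro _ v wv)).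
split => //; apply: Lfun_ae_eq (weak_derivative_unique W wv) lv.
- by case: W => _ [_ []].
- by case: wv => _ [_ []].
Qed.

Lemma wderiv_le_Sobolev_norm k u j : (j <= k)%N ->
  fine ('N[mu]_2%:E[EFin \o wderiv X j u])%E <= Sobolev_norm X k u.
Proof.
move=> jk; set c := fine _.
have c0 : 0 <= c by rewrite fine_ge0 // Lnorm_ge0.
rewrite -(ger0_norm c0) -sqrtr_sqr ler_sqrt; last first.
  by apply: sumr_ge0 => i _; exact: sqr_ge0.
rewrite (bigD1 (Ordinal (jk : (j < k.+1)%N))) //= lerDl.
by apply: sumr_ge0 => i _; exact: sqr_ge0.
Qed.

(** [rho *+ 2] is the length of [-rho, rho], outside which [phi] vanishes on the cell. *)
Lemma bounded_Lnorm2 phi (c rho : R) : measurable_fun setT phi -> 0 <= rho ->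
  (forall x, `|phi x| <= c) -> (forall x, cell x -> rho < `|x| -> phi x = 0) ->
  ('N[mu]_2%:E[EFin \o phi] <= (Num.sqrt (c ^+ 2 * (rho *+ 2)))%:E)%E.
Proof.
move=> mphi rho0 phic phi0.
have mC := @measurable_cell R X.
have c0 : 0 <= c by apply: le_trans (phic 0).
have D0 : 0 <= c ^+ 2 * (rho *+ 2) by rewrite mulr_ge0 ?sqr_ge0 // mulrn_wge0.
have E x : (`|(EFin \o phi) x| `^ 2 = (phi x ^+ 2)%:E)%E.
  by rewrite /= powR_mulrn // real_normK ?num_real.
suff H : (\int[mu]_x `|(EFin \o phi) x| `^ 2 <= (c ^+ 2 * (rho *+ 2))%:E)%E.
  have -> : (Num.sqrt (c ^+ 2 * (rho *+ 2)))%:E = ((c ^+ 2 * (rho *+ 2))%:E `^ 2^-1)%E.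
    by rewrite poweR12_sqrt ?lee_fin.
  rewrite unlock; apply: gt0_ler_poweR => //.
    by rewrite in_itv /= leey andbT integral_ge0 // => x _; exact: poweR_ge0.
  by rewrite in_itv /= leey andbT lee_fin.
have m2 : measurable_fun setT (fun x => (phi x ^+ 2)%:E).
  by apply/measurable_EFinP; exact: measurable_funX.
under eq_integral do rewrite E.
rewrite integral_muX //.
pose I : set R := `[- rho, rho]%classic.
have mI : measurable I by exact: measurable_itv.
pose g : R -> \bar R := (fun=> (c ^+ 2)%:E) \_ I.
have L : (\int[leb]_(x in cell) (phi x ^+ 2)%:E <= \int[leb]_(x in cell) g x)%E.
  apply: ge0_le_integral => //.
  - by move=> x _; rewrite lee_fin sqr_ge0.
  - exact: measurable_funTS.
  - have mg : measurable_fun setT g by exact/(measurable_restrictT _ mI)/measurable_cst.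
    exact: measurable_funTS.
  move=> x cx; rewrite /g patchE; case: ifPn => [_|].
    rewrite lee_fin -[phi x ^+ 2]real_normK ?num_real // lerXn2r ?nnegrE //.
  move=> /negP xr; rewrite phi0 ?expr0n // ltNge; apply/negP => h.
  by apply: xr; rewrite inE /I /= in_itv /= -ler_norml.
apply: (le_trans L); rewrite /g -integral_mkcondr.
have L2 : (\int[leb]_(x in cell `&` I) (c ^+ 2)%:E <=
    \int[leb]_(x in I) (c ^+ 2)%:E)%E.
  apply: ge0_subset_integral => //; first exact: measurableI.
  by move=> x _; rewrite lee_fin sqr_ge0.
apply: (le_trans L2).
have lebI : (leb I <= (rho *+ 2)%:E)%E.
  rewrite /I lebesgue_measure_itv /=.
  by case: ifPn => _; rewrite -?EFinD ?opprK ?lee_fin ?mulr2n // addr_ge0.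
have -> : (\int[leb]_(x in I) (c ^+ 2)%:E = (c ^+ 2)%:E * leb I)%E.
  exact: integral_cst.
by rewrite [X in (_ <= X)%E](EFinM (c ^+ 2) (rho *+ 2)) lee_wpmul2l // lee_fin sqr_ge0.
Qed.

(** Cauchy-Schwarz, obtained as the Hoelder inequality with both exponents equal to 2. *)
Lemma Rintegral_mul_le_Lnorm2 v w : v \in Lfun mu 2%:E -> w \in Lfun mu 2%:E ->
  `|\int[mu]_x (v x * w x)| <=
  fine ('N[mu]_2%:E[EFin \o v])%E * fine ('N[mu]_2%:E[EFin \o w])%E.
Proof.
move=> lv lw.
have fin z : z \in Lfun mu 2%:E -> ('N[mu]_2%:E[EFin \o z])%E \is a fin_num.
  rewrite inE => /andP[_]; rewrite inE /= /finite_norm => h.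
  by rewrite ge0_fin_numE ?Lnorm_ge0.
have m z : z \in Lfun mu 2%:E -> measurable_fun setT z.
  by rewrite inE => /andP[]; rewrite inE.
have /Lfun1_integrable i := Lfun2_mul_Lfun1 lv lw.
apply: le_trans (le_normr_Rintegral measurableT i) _.
have ia := @integrable_abse _ _ _ mu _ _ i.
have fi := @integrable_fin_num _ _ _ mu _ measurableT _ ia.
have half : 2^-1 + 2^-1 = 1 :> R by rewrite [RHS]splitr !div1r.
have H := hoelder mu (m _ lv) (m _ lw) (ltr0n R 2) (ltr0n R 2) half.
rewrite -lee_fin EFinM !fineK ?fin //.
by apply: le_trans H; rewrite Lnorm1.
Qed.

(** All j derivatives move to [u], so the bound sees the sup of [phi] and not that of its
    derivatives. *)
Lemma pairing_le k u j phi (c rho : R) : Sobolev X k u -> (j <= k)%N ->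
  test_function X phi -> 0 <= rho -> (forall x, `|phi x| <= c) ->
  (forall x, cell x -> rho < `|x| -> phi x = 0) ->
  `|\int[mu]_x (u x * phi^`(j) x)| <=
  Sobolev_norm X k u * Num.sqrt (c ^+ 2 * (rho *+ 2)).
Proof.
move=> hu jk tphi rho0 phic phi0.
have [[_ _ W] L] := wderivP hu jk.
have mphi : measurable_fun setT phi.
  exact: (continuous_measurable_fun (smooth_continuous (test_function_smooth tphi))).
have N := bounded_Lnorm2 mphi rho0 phic phi0.
have Lphi : phi \in Lfun mu 2%:E.
  rewrite inE; apply/andP; split; rewrite inE //=.
  by apply: le_lt_trans N _; rewrite ltry.
rewrite W // normrM normrX normrN normr1 expr1n mul1r.
apply: le_trans (Rintegral_mul_le_Lnorm2 L Lphi) _.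
apply: ler_pM; rewrite ?fine_ge0 ?Lnorm_ge0 //.
  exact: wderiv_le_Sobolev_norm.
rewrite -lee_fin fineK // ge0_fin_numE ?Lnorm_ge0 //.
by apply: le_lt_trans N _; rewrite ltry.
Qed.

End SobolevTheory.

(** * The Helmholtz equation *)

Section LinearODE.
Variable R : realType.
Local Notation leb := (@lebesgue_measure R).
Implicit Types (f g p q psi theta Psi : R -> R) (a b c l x : R).

Lemma continuous_primitive g a : continuous g ->
  exists2 G, forall x, is_derive x 1 G (g x) & G a = 0.
Proof.
move=> cg.
pose P c x := \int[leb]_(y in `[c, x]) g y.
have ig c d : leb.-integrable `[c, d] (EFin \o g).
  apply: continuous_compact_integrable; first exact: segment_compact.
  exact: continuous_subspaceT.
have PB c d x : c <= d -> d <= x -> P c x - P c d = P d x - P d d.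
  by move=> cd dx; rewrite !Rintegral_itvB ?bnd_simp.
have Pcst c d x : c <= d -> d <= x -> d <= a -> P c x - P c a = P d x - P d a.
  move=> cd dx da; have := PB c d x cd dx; have := PB c d a cd da.
  by move: (P c x) (P c d) (P d x) (P d d) (P c a) (P d a) => *; lra.
have min1 x : Num.min x a - 1 <= x /\ Num.min x a - 1 <= a.
  by rewrite /Num.min; case: ifPn => ?; split; lra.
(* The base point lies below both x and a, so the formula makes sense on either side of a;
   subtracting the value at a makes it independent of the base point. *)
exists (fun x => P (Num.min x a - 1) x - P (Num.min x a - 1) a); last by rewrite subrr.
(* The margin 2 keeps the fixed base [c] at or below min (y, a) - 1 for all y > x - 1, hence for all
   y near x. *)
move=> x; pose c := Num.min x a - 2.
apply: (@near_eq_is_derive _ _ _ (fun y => P c y - P c a)).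
  near=> y.
  have cx : x - 1 < y by near: y; apply: lt_nbhsr; lra.
  have [my ma] := min1 y.
  apply: Pcst => //; move: my ma; rewrite /c /Num.min.
  by case: ifPn => ?; case: ifPn => ?; lra.
have cx : c < x by rewrite /c /Num.min; case: ifPn => ?; lra.
have xx1 : x < x + 1 by lra.
have [dP EP] := continuous_FTC1_closed xx1 (ig c (x + 1)) cx (cg x).
have D : is_derive x 1 (P c) (g x) by rewrite -EP; exact: is_derive1P.
by rewrite -[g x]subr0; exact: is_deriveB.
Unshelve. all: by end_near. Qed.

Lemma derivable_nondecreasing f (df : R -> R) a b x y :
  (forall x, is_derive x 1 f (df x)) ->
  (forall x, a <= x <= b -> 0 <= df x) -> a <= x -> x <= y -> y <= b -> f x <= f y.
Proof.
move=> fdf df0 ax xy yb.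
have cf : {within `[x, y], continuous f}.
  apply: continuous_subspaceT => z; apply: differentiable_continuous.
  by apply/derivable1_diffP; case: (fdf z).
have [z] := MVT_segment xy (fun z _ => fdf z) cf.
rewrite in_itv /= => /andP[xz zy] E; rewrite -subr_ge0 E mulr_ge0 ?subr_ge0 //.
by apply: df0; rewrite (le_trans ax xz) (le_trans zy yb).
Qed.

Lemma is_derive_expR_affine l a x :
  is_derive x 1 (fun y => expR (l * (y - a))) (l * expR (l * (x - a))).
Proof.
have D : is_derive x 1 (fun y => l * (y - a)) l.
  have D1 : is_derive x 1 (fun y : R => y - a) (1 - 0) by exact: is_deriveB.
  have D2 := is_deriveZ l D1.
  by apply: (is_derive_eq D2); rewrite subr0 /GRing.scale /= mulr1.
by rewrite mulrC; exact: (is_derive1_comp (is_derive_expR _) D).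
Qed.

Lemma smooth_expR_affine l a : smooth (fun y => expR (l * (y - a))).
Proof. exact: (smooth_comp (smooth_expR R) (smooth_affine l a)). Qed.

(** Variation of constants, with G a primitive of exp (- l (x - a)) psi. *)
Lemma linear_ode l psi a c : smooth psi ->
  exists p, [/\ smooth p, forall x, p^`() x = l * p x + psi x & p a = c].
Proof.
move=> spsi.
have sg : smooth (fun x => expR ((- l) * (x - a)) * psi x).
  exact: (smoothM (smooth_expR_affine _ _) spsi).
have [G dG Ga] := continuous_primitive a (smooth_continuous sg).
have sG : smooth G by apply: smoothS => [x|]; [case: (dG x)|rewrite (derive1_eq dG)].
exists (fun x => expR (l * (x - a)) * (c + G x)); split.
- exact: (smoothM (smooth_expR_affine _ _) (smoothD (smooth_cst c) sG)).
- move=> x; apply: is_derive1E.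
  have D1 : is_derive x 1 (fun x => c + G x) (0 + expR (- l * (x - a)) * psi x).
    by have := dG x => ?; exact: is_deriveD.
  have D := is_deriveM (is_derive_expR_affine l a x) D1.
  apply: (is_derive_eq D); rewrite /GRing.scale /= add0r mulNr.
  have := expRxMexpNx_1 (l * (x - a)).
  move: (expR _) (expR (- _)) => e1 e2 e12.
  by rewrite [e1 * (e2 * _)]mulrA e12; ring.
- by rewrite subrr mulr0 expR0 Ga addr0 mul1r.
Qed.

(** Once the exponential factor is removed, the derivative of q is at most K theta in absolute
    value, so K Psi - q and K Psi + q are nondecreasing on [a, b]. The bound thus involves the
    integral of theta and not its sup, as an approximate delta requires. *)
Lemma linear_ode_bound l p psi theta Psi a b x : smooth p ->
  (forall x, p^`() x = l * p x + psi x) ->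
  (forall x, is_derive x 1 Psi (theta x)) ->
  (forall x, a <= x <= b -> `|psi x| <= theta x) ->
  a <= x <= b ->
  `|p x| <= expR (`|l| * (b - a)) * (`|p a| + expR (`|l| * (b - a)) * (Psi b - Psi a)).
Proof.
move=> sp pE dPsi psi_theta /andP[ax xb].
set K := expR _.
have K0 : 0 <= K by exact: expR_ge0.
have expK (s y : R) : `|s| <= `|l| -> a <= y <= b -> expR (s * (y - a)) <= K.
  move=> sl /andP[ay yb]; rewrite ler_expR (le_trans (ler_norm _)) // normrM.
  by apply: ler_pM => //; rewrite ger0_norm ?lerD2r // subr_ge0.
pose q y := expR (- l * (y - a)) * p y.
have dq (y : R) : is_derive y 1 q (expR (- l * (y - a)) * psi y).
  have D := is_deriveM (is_derive_expR_affine (- l) a y) (smooth_is_derive y sp).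
  by apply: (is_derive_eq D); rewrite /GRing.scale /= pE; ring.
have key (e : R) : `|e| = 1 -> e * q x - e * q a <= K * (Psi b - Psi a).
  move=> e1.
  have D (y : R) : is_derive y 1 (fun y => K * Psi y - e * q y)
      (K * theta y - e * (expR (- l * (y - a)) * psi y)).
    by have := is_deriveB (is_deriveZ K (dPsi y)) (is_deriveZ e (dq y)).
  have D0 (y : R) : a <= y <= b -> 0 <= K * theta y - e * (expR (- l * (y - a)) * psi y).
    move=> yab; rewrite subr_ge0 (le_trans (ler_norm _)) // normrM e1 mul1r normrM.
    rewrite ler_pM // ?psi_theta // ger0_norm ?expR_ge0 // expK // normrN //.
  have := derivable_nondecreasing D D0 (lexx a) ax xb.
  have DP (y : R) : a <= y <= b -> 0 <= theta y.
    by move=> yab; exact: le_trans (normr_ge0 _) (psi_theta y yab).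
  have := ler_wpM2l K0 (derivable_nondecreasing dPsi DP ax xb (lexx b)).
  by rewrite mulrBr; lra.
have qa : q a = p a by rewrite /q subrr mulr0 expR0 mul1r.
have qx : `|q x| <= `|p a| + K * (Psi b - Psi a).
  have := key 1 (normr1 _); have := key (-1); rewrite normrN1 => /(_ erefl).
  rewrite !mulN1r !mul1r qa => h1 h2.
  have := ler_norm (p a); have := ler_norm (- p a); rewrite normrN => h3 h4.
  by rewrite ler_norml; apply/andP; split; lra.
have -> : p x = expR (l * (x - a)) * q x.
  by rewrite /q mulrA mulNr expRxMexpNx_1 mul1r.
by rewrite normrM ler_pM // ger0_norm ?expR_ge0 // expK // ax.
Qed.

End LinearODE.

Section Helmholtz.
Variables (R : realType) (X : domain).
Implicit Types (f g p q psi theta Psi v phi : R -> R) (a b c l r x y : R).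

(** The function p (x + 1) - p x solves the homogeneous equation, so it is a multiple of exp (l x),
    and it vanishes at a. *)
Lemma periodic_ode l p psi a : smooth p -> (forall x, p^`() x = l * p x + psi x) ->
  periodic psi 1 -> p (a + 1) = p a -> periodic p 1.
Proof.
move=> sp pE ppsi pa x.
pose w y := expR (- l * (y - a)) * (p (y + 1) - p y).
have dw (y : R) : is_derive y 1 w 0.
  have D1 : is_derive y 1 (fun y => p (y + 1)) (p^`() (y + 1)).
    have D0 : is_derive y 1 (fun y : R => y + 1) (1 + 0) by exact: is_deriveD.
    have := @is_derive1_comp R p (fun y => y + 1) y _ _ (smooth_is_derive (y + 1) sp) D0.
    by rewrite addr0 mulr1.
  have D2 : is_derive y 1 (fun y => p (y + 1) - p y) (p^`() (y + 1) - p^`() y).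
    exact: (is_deriveB D1 (smooth_is_derive y sp)).
  have D := is_deriveM (is_derive_expR_affine (- l) a y) D2.
  by apply: (is_derive_eq D); rewrite /GRing.scale /= !pE ppsi; ring.
have /eqP : w x = w a by exact: is_derive_0_is_cst.
rewrite /w pa !subrr !mulr0 mulf_eq0 gt_eqF ?expR_gt0 //=.
by rewrite subr_eq0 => /eqP.
Qed.

(* On the circle, a multiple of exp (l x) is added to a solution so that its
   values at a and a + 1 agree. *)
Lemma linear_ode_solution l a b : l != 0 -> a <= b -> (X = Circle -> b = a + 1) ->
  exists2 C : R, 0 <= C & forall psi theta Psi, smooth psi -> fun_on X psi ->
    (forall x, is_derive x 1 Psi (theta x)) ->
    (forall x, a <= x <= b -> `|psi x| <= theta x) ->
    exists p, [/\ smooth p, fun_on X p, forall x, p^`() x = l * p x + psi x &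
      forall x, a <= x <= b -> `|p x| <= C * (Psi b - Psi a)].
Proof.
move=> l0 ab Xab; set K := expR (`|l| * (b - a)).
have K0 : 0 <= K by exact: expR_ge0.
have el0 : 1 - expR l != 0.
  by rewrite subr_eq0 eq_sym -expR0 (inj_eq (@expR_inj R)).
(* The first term bounds the solution vanishing at a; the second bounds the homogeneous correction
   made on the circle, whose coefficient has the divisor 1 - e^l. *)
exists (K * K + K * K / `|1 - expR l| * K).
  by rewrite addr_ge0 // ?mulr_ge0 // ?invr_ge0.
move=> psi theta Psi spsi ppsi dPsi psi_theta.
have [p [sp pE pa]] := linear_ode l a 0 spsi.
have pK x : a <= x <= b -> `|p x| <= K * K * (Psi b - Psi a).
  move=> xab; have := linear_ode_bound sp pE dPsi psi_theta xab.
  by rewrite pa normr0 add0r mulrA.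
have bab : a <= b <= b by rewrite ab lexx.
have m0 : 0 <= K * K * (Psi b - Psi a) by exact: le_trans (normr_ge0 _) (pK b bab).
case: X Xab ppsi => [_ _|/(_ erefl) bE ppsi].
  exists p; split => // x /pK px; apply: (le_trans px).
  rewrite mulrDl lerDl.
  have -> : K * K / `|1 - expR l| * K * (Psi b - Psi a) =
    K * K * (Psi b - Psi a) * (`|1 - expR l|^-1 * K) by ring.
  by rewrite mulr_ge0 // mulr_ge0 // invr_ge0.
(* Solves d = p b + d e^l: the corrected values agree at a, where p vanishes, and at b = a + 1. *)
pose d := p b / (1 - expR l).
have sE := smooth_expR_affine l a.
exists (fun x => p x + d * expR (l * (x - a))); split.
- exact: (smoothD sp (smoothM (smooth_cst d) sE)).
- apply: (@periodic_ode l _ psi a) => //.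
  + exact: (smoothD sp (smoothM (smooth_cst d) sE)).
  + move=> x; apply: is_derive1E.
    have D := is_deriveD (smooth_is_derive x sp)
      (is_deriveZ d (is_derive_expR_affine l a x)).
    by apply: (is_derive_eq D); rewrite /GRing.scale /= pE; ring.
  + have a1 : a + 1 - a = 1 by ring.
    by rewrite a1 subrr mulr0 expR0 !mulr1 pa add0r -bE /d; field.
- move=> x; apply: is_derive1E.
  have D := is_deriveD (smooth_is_derive x sp)
      (is_deriveZ d (is_derive_expR_affine l a x)).
  by apply: (is_derive_eq D); rewrite /GRing.scale /= pE; ring.
- move=> x xab; rewrite mulrDl (le_trans (ler_normD _ _)) // lerD ?pK //.
  rewrite normrM mulrAC ler_pM //.
    by rewrite /d normrM normfV mulrAC ler_wpM2r ?invr_ge0 // pK.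
  rewrite ger0_norm ?expR_ge0 // ler_expR (le_trans (ler_norm _)) // normrM.
  move: xab => /andP[ax xb].
  by rewrite ler_wpM2l // ger0_norm ?lerD2r // subr_ge0.
Qed.

(* The operator 1 - d^2/dx^2 factors as (1 - d/dx)(1 + d/dx). *)
Lemma helmholtz_solution a b : a <= b -> (X = Circle -> b = a + 1) ->
  exists2 C : R, 0 <= C & forall psi Psi, smooth psi -> fun_on X psi ->
    (forall x, 0 <= psi x) -> (forall x, is_derive x 1 Psi (psi x)) ->
    exists phi, [/\ smooth phi, fun_on X phi,
      forall x, phi x - phi^`(2) x = psi x &
      forall x, a <= x <= b ->
        `|phi x| <= C * (Psi b - Psi a) /\ `|phi^`() x| <= C * (Psi b - Psi a)].
Proof.
move=> ab Xab.
have [C1 C10 H1] := linear_ode_solution (oner_neq0 R) ab Xab.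
have n10 : - 1 != 0 :> R by rewrite oppr_eq0 oner_neq0.
have [C2 C20 H2] := linear_ode_solution n10 ab Xab.
have ba0 : 0 <= b - a by rewrite subr_ge0.
(* The first equation gives |p| <= C1 m, with m the mass of psi. Used as a constant majorant on
   [a, b], this gives |q| <= C2 C1 m (b - a) in the second one, and q' = p - q is bounded by the sum
   of both. *)
exists (C2 * (C1 * (b - a)) + C1).
  by rewrite addr_ge0 // !mulr_ge0.
move=> psi Psi spsi ppsi psi0 dPsi; set m := Psi b - Psi a.
have [p [sp pp pE pm]] : exists p, [/\ smooth p, fun_on X p,
    forall x, p^`() x = 1 * p x + -1 * psi x &
    forall x, a <= x <= b -> `|p x| <= C1 * m].
  apply: (H1 _ psi) => //.
  - exact: (smoothM (smooth_cst (-1)) spsi).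
  - by move: ppsi; rewrite /fun_on; case: (X) => // ppsi x; rewrite ppsi.
  - by move=> x _; rewrite normrM normrN1 mul1r ger0_norm.
have dm (x : R) : is_derive x 1 (fun y => C1 * m * y) (C1 * m).
  have D := is_deriveZ (C1 * m) (is_derive_id x 1).
  by apply: (is_derive_eq D); rewrite /GRing.scale /= mulr1.
have [q [sq pq qE qm]] := H2 p (cst (C1 * m)) _ sp pp dm pm.
have m0 : 0 <= C1 * m.
  by apply: le_trans (normr_ge0 _) (pm a _); rewrite lexx.
exists q; split => //.
- move=> x; have -> : q^`(2) x = q x - psi x; last by ring.
  rewrite derive1nS derive1n1; apply: is_derive1E.
  have -> : q^`() = fun x => -1 * q x + p x by apply/funext => y; rewrite qE.
  have D := is_deriveD (is_deriveZ (-1) (smooth_is_derive x sq)) (smooth_is_derive x sp).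
  by apply: (is_derive_eq D); rewrite /GRing.scale /= qE pE; ring.
- move=> x xab; have := qm x xab; have := pm x xab.
  rewrite -!mulrBr => h1 h2.
  have E : C2 * (C1 * m * (b - a)) + C1 * m = (C2 * (C1 * (b - a)) + C1) * m by ring.
  have h2' : `|q x| + `|p x| <= (C2 * (C1 * (b - a)) + C1) * m by rewrite -E lerD.
  split; first by apply: le_trans h2'; rewrite lerDl.
  apply: le_trans h2'; rewrite qE mulN1r (le_trans (ler_normD _ _)) // normrN //.
Qed.

(** A is positive exactly for |x| < r + 1 and B exactly for |x| > r + 1/2, so A + B never vanishes
    and A / (A + B) is the cutoff. Being 1 on a neighbourhood of [-r, r], it leaves second
    derivatives there undisturbed. *)
Lemma smooth_cutoff r : 0 <= r -> exists chi : R -> R,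
  [/\ smooth chi, forall x, `|x| < r + 2^-1 -> chi x = 1 &
      forall x, r + 1 < `|x| -> chi x = 0].
Proof.
move=> r0.
have sN (e d : R) : smooth (fun x => e * x ^+ 2 + d).
  have H := smoothD (smoothM (smooth_cst e)
    (smoothM (smooth_id R) (smooth_id R))) (smooth_cst d).
  by under eq_fun do rewrite expr2.
pose A x := flat 0 (-1 * x ^+ 2 + (r + 1) ^+ 2).
pose B x := flat 0 (1 * x ^+ 2 + - (r + 2^-1) ^+ 2).
have sA : smooth A := smooth_comp (smooth_flat R 0) (sN _ _).
have sB : smooth B := smooth_comp (smooth_flat R 0) (sN _ _).
have AB x : 0 < A x + B x.
  have [xr|xr] := ltP `|x| (r + 1).
    rewrite ltr_pwDl ?flat_ge0 // flat_gt0 mulN1r addrC subr_gt0.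
    by rewrite -[x ^+ 2]real_normK ?num_real // ltr_pXn2r ?nnegrE //; lra.
  rewrite ltr_wpDl ?flat_ge0 // flat_gt0 mul1r subr_gt0.
  by rewrite -[x ^+ 2]real_normK ?num_real // ltr_pXn2r ?nnegrE //; lra.
exists (fun x => A x * (A x + B x)^-1); split.
- apply: smoothM => //; apply: smoothV; first by move=> x; rewrite gt_eqF.
  exact: smoothD.
- move=> x xr; have B0 : B x = 0.
    apply/eqP; rewrite eq_le flat_ge0 andbT leNgt flat_gt0 -leNgt mul1r subr_le0.
    by rewrite -[x ^+ 2]real_normK ?num_real // lerXn2r ?nnegrE //; lra.
  by have := AB x; rewrite B0 addr0 => A0; rewrite divff // gt_eqF.
- move=> x xr; have A0 : A x = 0.
    apply/eqP; rewrite eq_le flat_ge0 andbT leNgt flat_gt0 -leNgt mulN1r addrC subr_le0.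
    by rewrite -[x ^+ 2]real_normK ?num_real // lerXn2r ?nnegrE //; lra.
  by rewrite A0 mul0r.
Qed.

End Helmholtz.

(** * Test functions from the Helmholtz equation *)

Section HelmholtzTest.
Variables (R : realType) (X : domain).
Local Notation cell := (@cell R X).
Implicit Types (f g p q psi theta Psi v phi : R -> R) (a b c l r x y B C : R).

(* On the line, [-r, r] with room for a cutoff; on the circle, one period. *)
Definition window_lo r : R := match X with Line => - (r + 1) | Circle => 0 end.
Definition window_hi r : R := match X with Line => r + 1 | Circle => 1 end.

(** Carries pointwise bounds from one period to all of R. On the line y is x itself, and the radius
    |x| only serves to place it in its window. *)
Lemma fun_on_cell f x : fun_on X f ->
  exists2 y, cell y /\ window_lo `|x| <= y < window_hi `|x| & f x = f y.
Proof.
rewrite /fun_on /Defs.cell /window_lo /window_hi; case: (X) => [_|pf].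
  exists x => //; split => //.
  by have := ler_norm x; have := ler_norm (- x); rewrite normrN => *; lra.
pose m := Num.floor x; exists (x - m%:~R); last first.
  by rewrite -[in LHS](subrK m%:~R x) (periodic_int _ _ pf).
have /andP[m1 m2] := floor_itv x.
move: m1 m2; rewrite -/m intrD => m1 m2.
by rewrite /= in_itv /=; split; lra.
Qed.

Lemma helmholtz_test r : 0 <= r -> exists2 C : R, 0 < C &
  forall psi Psi, smooth psi -> fun_on X psi -> (forall x, 0 <= psi x) ->
    (forall x, is_derive x 1 Psi (psi x)) ->
  exists phi, [/\ test_function X phi,
    forall x, cell x -> `|x| <= r -> phi x - phi^`(2) x = psi x,
    forall x, `|phi x| <= C * (Psi (window_hi r) - Psi (window_lo r)),
    forall x, `|phi^`() x| <= C * (Psi (window_hi r) - Psi (window_lo r)) &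
    forall x, cell x -> r + 1 < `|x| -> phi x = 0].
Proof.
move=> r0; set a := window_lo r; set b := window_hi r.
have ab : a <= b by rewrite /a /b /window_lo /window_hi; case: (X); lra.
have Xab : X = Circle -> b = a + 1.
  by rewrite /a /b /window_lo /window_hi; case: (X) => // _; rewrite add0r.
have [C C0 H] := helmholtz_solution ab Xab.
have [chi [schi chi1 chi0]] := smooth_cutoff r0.
have cchi := smooth_continuous schi.
have cdchi := smooth_continuous (smooth_derive1 schi).
have [M1 M10 hM1] := compact_continuous_bounded (@segment_compact _ a b) cchi.
have [M2 M20 hM2] := compact_continuous_bounded (@segment_compact _ a b) cdchi.
(* M1 and M2 bound the cutoff and its derivative in the product rule; the 1 beside them covers the
   circle, where nothing is cut off, and the points outside the window; the last 1 makes the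
   constant positive. *)
exists ((M1 + M2 + 1) * C + 1); first by rewrite ltr_wpDl // mulr_ge0 //; lra.
move=> psi Psi spsi ppsi psi0 dPsi; set m := Psi b - Psi a.
have m0 : 0 <= m.
  have := @derivable_nondecreasing _ _ _ a b a b dPsi _ (lexx a) ab (lexx b).
  by rewrite -subr_ge0; apply => x _.
have [phi [sphi pphi phiE phim]] := H psi Psi spsi ppsi psi0 dPsi.
have bound z : z <= (M1 + M2) * (C * m) \/ z <= C * m -> z <= ((M1 + M2 + 1) * C + 1) * m.
  have : 0 <= C * m by rewrite mulr_ge0.
  have : 0 <= (M1 + M2) * (C * m) by rewrite !mulr_ge0 // addr_ge0.
  have -> : ((M1 + M2 + 1) * C + 1) * m = (M1 + M2) * (C * m) + C * m + m by ring.
  by move: ((M1 + M2) * (C * m)) (C * m) => s t s0 t0 [] ?; lra.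
have [XE|XE] : X = Line \/ X = Circle by case: (X); [left|right].
- exists (fun x => chi x * phi x).
  have s2 : smooth (fun x => chi x * phi x) by exact: smoothM.
  have out x : r + 1 < `|x| -> chi x * phi x = 0 by move=> /chi0 ->; rewrite mul0r.
  have inab x : `|x| <= r + 1 -> x \in `[a, b].
    by rewrite /a /b /window_lo /window_hi XE in_itv /= ler_norml.
  have near_gt (x s : R) : s < `|x| -> \forall y \near x, s < `|y|.
    by move=> sx; exact: (cvgr_gt _ (@norm_continuous _ R x)).
  have near_lt (x s : R) : `|x| < s -> \forall y \near x, `|y| < s.
    by move=> sx; exact: (cvgr_lt _ (@norm_continuous _ R x)).
  have out_near x : r + 1 < `|x| -> \near x, chi x * phi x = cst 0 x.
    move=> xr; near=> y; apply: out.
    by near: y; exact: near_gt.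
  split.
  + apply: test_functionP => //; first by rewrite /fun_on XE.
    by exists (r + 1) => x _; exact: out.
  + move=> x _ xr; rewrite -phiE (chi1 x) ?mul1r; last lra.
    have in_near : \near x, chi x * phi x = phi x.
      near=> y; rewrite chi1 ?mul1r //; near: y.
      by apply: near_lt; lra.
    by rewrite (derive1n_near_eq 2 in_near).
  + move=> x; have [xr|xr] := lerP `|x| (r + 1); last first.
      by rewrite out // normr0; apply: bound; right; rewrite mulr_ge0.
    apply: bound; left; rewrite normrM mulrDl.
    have xab := inab x xr; have := hM1 x xab => h1.
    have [|h2 _] := phim x; first by move: xab; rewrite in_itv.
    apply: le_trans (ler_pM _ _ h1 h2) _ => //.
    by rewrite lerDl !mulr_ge0.
  + move=> x; have [xr|xr] := lerP `|x| (r + 1); last first.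
      have := derive1n_near_eq 1 (out_near x xr); rewrite !derive1n1 => ->.
      by rewrite derive1_cst normr0; apply: bound; right; rewrite mulr_ge0.
    apply: bound; left.
    have D := is_deriveM (smooth_is_derive x schi) (smooth_is_derive x sphi).
    rewrite (is_derive1E D) /GRing.scale /= (le_trans (ler_normD _ _)) // mulrDl.
    have xab := inab x xr; have := hM1 x xab => h1; have := hM2 x xab => h1'.
    have [|h2 h2'] := phim x; first by move: xab; rewrite in_itv.
    apply: lerD; rewrite normrM; first exact: ler_pM.
    by rewrite mulrC; exact: ler_pM.
  + by move=> x _; exact: out.
- have per f : fun_on X f -> (forall x, a <= x <= b -> `|f x| <= C * m) ->
      forall x, `|f x| <= C * m.
    move=> pf fm x; have [y [_ +] ->] := fun_on_cell x pf.
    rewrite /window_lo /window_hi XE => /andP[y0 y1]; apply: fm.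
    by rewrite /a /b /window_lo /window_hi XE y0 ltW.
  exists phi; split.
  + apply: test_functionP => //.
    exists 1 => x; rewrite /Defs.cell XE /= in_itv /= => /andP[x0 x1].
    by rewrite ger0_norm // ltNge x1.
  + by move=> x _ _; exact: phiE.
  + by move=> x; apply: bound; right; apply: per => [//|y /phim[]].
  + move=> x; apply: bound; right; apply: per => [|y /phim[]//].
    exact: (@fun_on_derive1n _ _ _ 1).
  + move=> x; rewrite /Defs.cell XE /= in_itv /= => /andP[x0 x1].
    by rewrite ger0_norm // => ?; lra.
Unshelve. all: by end_near. Qed.

End HelmholtzTest.

(** * Sup bounds by duality *)

Section SupNorm.
Variables (R : realType) (X : domain).
Local Notation leb := (@lebesgue_measure R).
Local Notation mu := (muX R X).
Local Notation cell := (@cell R X).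
Implicit Types (f g p q psi theta Psi v phi : R -> R) (a b c l r x y B C : R).

Lemma Rintegral_primitive psi Psi a b : a < b -> continuous psi ->
  (forall x, is_derive x 1 Psi (psi x)) ->
  \int[leb]_(x in `[a, b]) psi x = Psi b - Psi a.
Proof.
move=> ab cpsi dPsi; rewrite /Rintegral.
have cPsi : continuous Psi.
  by move=> x; apply: differentiable_continuous; apply/derivable1_diffP; case: (dPsi x).
rewrite (@continuous_FTC2 _ psi Psi) //.
- exact: continuous_subspaceT.
- split; first by move=> x _; case: (dPsi x).
  + exact/cvg_at_right_filter/cPsi.
  + exact/cvg_at_left_filter/cPsi.
- by move=> x _; exact: is_derive1E.
Qed.

Lemma eq_Rintegral_cell f g : measurable_fun setT f -> measurable_fun setT g ->
  (forall x, cell x -> f x = g x) -> \int[mu]_x f x = \int[mu]_x g x.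
Proof.
move=> mf mg fg; rewrite /Rintegral !integral_muX; [|exact/measurable_EFinP..].
by congr fine; apply: eq_integral => x /set_mem cx; rewrite fg.
Qed.

Lemma L1loc_continuous v : continuous v -> fun_on X v -> L1loc X v.
Proof.
move=> cv pv; split => //; split; [exact: continuous_measurable_fun|exact: openT|].
move=> K _ cK.
have := @continuous_compact_integrable R v K cK (continuous_subspaceT cv).
by case/integrableP.
Qed.

Lemma integrable_helmholtz v phi : L1loc X v -> test_function X phi ->
  mu.-integrable setT (EFin \o (fun x => v x * (phi x - phi^`(2) x))) /\
  \int[mu]_x (v x * (phi x - phi^`(2) x)) =
  \int[mu]_x (v x * phi x) - \int[mu]_x (v x * phi^`(2) x).
Proof.
move=> lv tphi.
have i0 := L1loc_integrable_mul 0 lv tphi.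
have i2 := L1loc_integrable_mul 2 lv tphi.
have E : (fun x => v x * (phi x - phi^`(2) x)) =
    (fun x => v x * phi x - v x * phi^`(2) x) by apply/funext => x; rewrite mulrBr.
rewrite E; split; last exact: RintegralB.
exact: (@integrableB _ _ _ mu setT measurableT _ _ i0 i2).
Qed.

(* Near a point where v exceeds C B, test with the solution phi of
   phi - phi'' = psi, for psi a bump at that point. *)
Lemma sup_bound r : 0 <= r -> exists2 C : R, 0 < C &
  forall v B, continuous v -> fun_on X v ->
    (forall x, cell x -> r < `|x| -> v x = 0) ->
    (forall phi c, test_function X phi ->
      (forall x, `|phi x| <= c) -> (forall x, `|phi^`() x| <= c) ->
      (forall x, cell x -> r + 1 < `|x| -> phi x = 0) ->
      `|\int[mu]_x (v x * (phi x - phi^`(2) x))| <= B * c) ->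
    forall x, `|v x| <= C * B.
Proof.
move=> r0; have [C C0 H] := helmholtz_test X r0; exists C => //.
set a := window_lo X r in H; set b := window_hi X r in H.
have ab : a < b by rewrite /a /b /window_lo /window_hi; case: (X); lra.
(* An upper bound suffices, since it can be applied to both v and - v. *)
suff key v B : continuous v -> fun_on X v ->
    (forall x, cell x -> r < `|x| -> v x = 0) ->
    (forall phi c, test_function X phi ->
      (forall x, `|phi x| <= c) -> (forall x, `|phi^`() x| <= c) ->
      (forall x, cell x -> r + 1 < `|x| -> phi x = 0) ->
      `|\int[mu]_x (v x * (phi x - phi^`(2) x))| <= B * c) ->
    forall x, v x <= C * B.
  move=> v B cv pv v0 hv x; rewrite ler_norml lerNl; apply/andP; split; last exact: key.
  apply: (key (fun y => - v y)).
  - by move=> y; apply: continuousN; exact: cv.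
  - by move: pv; rewrite /fun_on; case: (X) => // pv y; rewrite pv.
  - by move=> y cy yr; rewrite v0 // oppr0.
  - move=> phi c tphi phic dphic phi0.
    have [i _] := integrable_helmholtz (L1loc_continuous cv pv) tphi.
    have -> : \int[mu]_x (- v x * (phi x - phi^`(2) x)) =
        -1 * \int[mu]_x (v x * (phi x - phi^`(2) x)).
      by rewrite -RintegralZl //; apply: eq_Rintegral => y _; ring.
    by rewrite normrM normrN1 mul1r; exact: hv.
move=> cv pv v0 hv x; rewrite leNgt; apply/negP => Bv.
(* Obtained by testing with the zero function and c = 1. Then v x > C B >= 0 forces the point into
   [-r, r] on the line. *)
have B0 : 0 <= B.
  have t0 : test_function X (cst 0 : R -> R).
    apply: (test_functionP (smooth_cst (0 : R))).
      by rewrite /fun_on; case: (X).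
    by exists 0.
  have := hv (cst 0) 1 t0; rewrite mulr1 => /(_ _ _ _)/(le_trans (normr_ge0 _)); apply => y //.
    by rewrite normr0.
  by rewrite derive1_cst normr0.
(* Strictly between C B and v x, so that continuity keeps v above [beta] near the point. *)
pose beta := (C * B + v x) / 2.
have [x0 [cx0 xab] E] : exists2 x0, cell x0 /\ a <= x0 < b & v x = v x0.
  have [y [cy yx] E] := fun_on_cell x pv; exists y => //; split => //.
  have [XE|XE] : X = Line \/ X = Circle by case: (X); [left|right].
    have yr : `|y| <= r.
      rewrite leNgt; apply/negP => /(v0 y cy) vy0; move: Bv.
      by rewrite E vy0 ltNge mulr_ge0 // ltW.
    move: yr; rewrite /a /b /window_lo /window_hi XE ler_norml => /andP[? ?].
    by apply/andP; split; lra.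
  by move: yx; rewrite /a /b /window_lo /window_hi XE.
have vx0 : beta < v x0 by rewrite -E /beta; lra.
have [e [e0 e2 ve]] : exists e,
    [/\ 0 < e, e < 2^-1 & forall y, `|y - x0| < e -> beta < v y].
  have : \forall y \near x0, beta < v y by apply: (cvgr_gt _ (cv x0)).
  move=> /nbhs_ballP[d /= d0 hd].
  exists (Num.min d (2^-1) / 2); split.
  - by rewrite divr_gt0 // lt_min d0 invr_gt0 ltr0n.
  - by rewrite /Num.min; case: ifPn => ?; lra.
  - move=> y yx; apply: hd; rewrite /ball /= distrC (lt_le_trans yx) //.
    by rewrite /Num.min; case: ifPn => ?; lra.
have [psi [spsi ppsi psi0 psiE]] := smooth_bump X x0 e0 e2.
have vpsi y : 0 < psi y -> beta < v y.
  move=> /psiE; move: pv; rewrite /near_mod /fun_on.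
  case: (X) => [_|pv [m hm]]; first exact: ve.
  have -> : v y = v (y - m%:~R) by rewrite -mulrNz (periodic_int _ _ pv).
  by apply: ve; rewrite addrAC.
have cpsi := smooth_continuous spsi.
have [Psi dPsi _] := continuous_primitive a cpsi.
pose m := Psi b - Psi a.
have mono s t : a <= s -> s <= t -> t <= b -> Psi s <= Psi t.
  by apply: (derivable_nondecreasing dPsi) => y _.
(* [x0] may be the left end of the window, so the mass of psi is found to its right, where x0 < b
   leaves room. *)
have m0 : 0 < m.
  pose d := Num.min e (b - x0) / 2.
  have /andP[ax xb] := xab.
  have d0 : 0 < d by rewrite divr_gt0 // lt_min e0 subr_gt0.
  have [de db] : d < e /\ d <= b - x0 by rewrite /d /Num.min; case: ifPn => ?; split; lra.
  have cPsi : {within `[x0, x0 + d], continuous Psi}.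
    apply: continuous_subspaceT => y; apply: differentiable_continuous.
    by apply/derivable1_diffP; case: (dPsi y).
  have xd : x0 < x0 + d by rewrite ltrDl.
  have [z] := MVT xd (fun z _ => dPsi z) cPsi.
  rewrite in_itv /= => /andP[xz zd] EP.
  have psiz : 0 < psi z.
    apply/psiE; have ze : `|z - x0| < e by rewrite ger0_norm; lra.
    by rewrite /near_mod; case: (X) => //; exists 0; rewrite subr0.
  have P1 := mono _ _ (lexx a) ax (ltW xb).
  have bd : x0 + d <= b by lra.
  have P2 := mono _ _ (le_trans ax (ltW xd)) bd (lexx b).
  have : 0 < psi z * (x0 + d - x0) by rewrite mulr_gt0 // addrC addKr.
  by rewrite -EP /m; lra.
have [phi [tphi phiE phic dphic phi0]] := H psi Psi spsi ppsi psi0 dPsi.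
have := hv phi _ tphi phic dphic phi0; rewrite -/m.
have -> : \int[mu]_x (v x * (phi x - phi^`(2) x)) = \int[mu]_x (v x * psi x).
  have sphi := test_function_smooth tphi.
  have mv := continuous_measurable_fun cv.
  apply: eq_Rintegral_cell.
  - apply: measurable_funM => //; apply: measurable_funB; apply: continuous_measurable_fun.
      exact: smooth_continuous.
    exact/smooth_continuous/smooth_derive1n.
  - by apply: measurable_funM => //; exact: continuous_measurable_fun.
  - move=> y cy; have [yr|ry] := lerP `|y| r; first by rewrite phiE.
    by rewrite v0 // !mul0r.
have mI : measurable (`[a, b]%classic : set R) by exact: measurable_itv.
have IC : `[a, b]%classic `<=` cell.
  by rewrite /a /b /window_lo /window_hi /Defs.cell; case: (X).
have cvpsi : continuous (fun y => v y * psi y).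
  by move=> y; apply: continuousM; [exact: cv|exact: cpsi].
have cbpsi : continuous (fun y => beta * psi y).
  exact: smooth_continuous (smoothM (smooth_cst beta) spsi).
have ig f : continuous f -> leb.-integrable `[a, b] (EFin \o f).
  move=> cf; apply: continuous_compact_integrable; first exact: segment_compact.
  exact: continuous_subspaceT.
have vpsi0 y : cell y -> ~ `[a, b]%classic y -> v y * psi y = 0.
  move=> cy yab; rewrite v0 ?mul0r // ltNge; apply/negP => yr; apply: yab.
  move: cy; rewrite /a /b /window_lo /window_hi /Defs.cell; case: (X) => // _.
  by move: yr; rewrite /= in_itv /= ler_norml; lra.
have [_ ->] := integral_muX_supp mI IC (continuous_measurable_fun cvpsi)
  (ig _ cvpsi) vpsi0.
have : beta * m <= \int[leb]_(y in `[a, b]) (v y * psi y).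
  rewrite -[m](Rintegral_primitive ab cpsi dPsi) -RintegralZl //; last exact: ig.
  apply: le_Rintegral => //.
  - exact: (ig _ cbpsi).
  - exact: (ig _ cvpsi).
  move=> y _; have [->|py] := eqVneq (psi y) 0; first by rewrite !mulr0.
  by rewrite ler_wpM2r // ltW // vpsi // lt_def py psi0.
(* Both estimates concern the integral of v psi; together with m > 0 they contradict C B < beta. *)
move=> h1 h2; have : beta * m <= C * B * m.
  by rewrite (le_trans h1) // (le_trans (ler_norm _)) // (le_trans h2) // mulrCA mulrA.
by rewrite ler_pM2r // /beta; lra.
Qed.

End SupNorm.

(** * Backward uniqueness *)

Section Preliminaries.
Variables (R : realType) (X : domain).
Local Notation mu := (muX R X).
Local Notation cell := (@cell R X).
Implicit Types (f g v w phi : R -> R) (u : R -> R -> R) (T : \bar R).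

Lemma support_bounds T u : (0 < T)%E -> compactly_supported X T u ->
  exists t0 r : R, [/\ before T t0, 0 <= r,
    forall t x, before T t -> t0 < t -> cell x -> u t x = 0 &
    forall t x, before T t -> cell x -> r < `|x| -> u t x = 0].
Proof.
rewrite /compactly_supported => T0; set K := _ `&` _ => cK.
have inK t x : before T t -> cell x -> u t x <> 0 -> K (t, x).
  move=> bt cx /eqP ux; split => //; split => //.
  exact: (@subset_closure _ [set p : R * R | before T p.1 /\ u p.1 p.2 != 0] (t, x)).
(* The largest time is attained in the support, hence is itself before T; if the support is empty, T
   > 0 makes time 0 available. *)
have [t0 [bt0 Kt0]] : exists t0, before T t0 /\ forall p, K p -> p.1 <= t0.
  have [K0|/set0P K0] := eqVneq K set0.
    by exists 0; split => // p; rewrite K0.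
  have [|p /set_mem [[_ bp] _] Kp] := @compact_EVT_max _ R fst K K0 cK.
    by apply: continuous_subspaceT => p; exact: cvg_fst.
  by exists p.1; split => // q Kq; apply: Kp; rewrite inE.
have [r r0 Kr] : exists2 r : R, 0 <= r & forall p, K p -> `|p.2| <= r.
  have /compact_bounded[M [_ KM]] : compact (snd @` K).
    by apply: continuous_compact => //; apply: continuous_subspaceT => p; exact: cvg_snd.
  exists (`|M| + 1) => [|p Kp]; first by rewrite addr_ge0.
  have M1 : M < `|M| + 1 by rewrite ltr_pwDr // ler_norm.
  by apply: (KM _ M1); exists p.
exists t0, r; split => // t x bt.
- move=> t0t cx; apply: contrapT => /(inK _ _ bt cx)/Kt0 /=.
  by rewrite leNgt t0t.
- move=> cx rx; apply: contrapT => /(inK _ _ bt cx)/Kr /=.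
  by rewrite leNgt rx.
Qed.

Lemma SobolevW k v : Sobolev X k.+1 v -> Sobolev X k v.
Proof. by move=> [lv hv]; split => // j jk; apply: hv; exact: leq_trans jk _. Qed.

Lemma Sobolev_L1loc k v : Sobolev X k v -> L1loc X v.
Proof. by move=> [_ /(_ 0%N (leq0n _))[w []]]. Qed.

(** On the line [phi] is zero near x; on the circle s >= 1 leaves no such point in [0, 1]. *)
Lemma derive1_supp phi (s : R) : 1 <= s -> fun_on X phi ->
  (forall x, cell x -> s < `|x| -> phi x = 0) ->
  forall x, cell x -> s < `|x| -> phi^`() x = 0.
Proof.
move=> s1 pphi phi0 x cx sx.
have [XE|XE] : X = Line \/ X = Circle by case: (X); [left|right].
  rewrite -derive1n1; apply: derive1n_near0; near=> y; apply: phi0.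
    by rewrite /Defs.cell XE.
  near: y; apply: (cvgr_gt _ (@norm_continuous _ R x)) => //.
move: cx sx; rewrite /Defs.cell XE /= in_itv /= => /andP[x0 x1].
by rewrite ger0_norm // => ?; lra.
Unshelve. all: by end_near. Qed.

(** phi'' is paired as the first derivative of the test function phi', so that one derivative falls
    on [v] and only the sups of phi and phi' enter, as [sup_bound] demands. Each of the two pairings
    contributes a factor c D, whence 2 D. *)
Lemma sup_le_Sobolev_norm (r : R) : 0 <= r -> exists2 C : R, 0 < C &
  forall k v, Sobolev X k.+1 v -> continuous v ->
    (forall x, cell x -> r < `|x| -> v x = 0) ->
    forall x, `|v x| <= C * Sobolev_norm X k.+1 v.
Proof.
move=> r0; have [C C0 H] := sup_bound X r0.
pose D := Num.sqrt ((r + 1) *+ 2).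
have D0 : 0 < D by rewrite sqrtr_gt0 mulrn_wgt0 // ltr_wpDl.
exists (C * (2 * D)); first by rewrite !mulr_gt0.
move=> k v hv cv v0 x.
have -> : C * (2 * D) * Sobolev_norm X k.+1 v =
  C * (Sobolev_norm X k.+1 v * (2 * D)) by ring.
have pv : fun_on X v by have [[]] := hv.
apply: H => // phi c tphi phic dphic phi0.
have [_ ->] := integrable_helmholtz (Sobolev_L1loc hv) tphi.
have c0 : 0 <= c by apply: le_trans (phic 0).
have E : Num.sqrt (c ^+ 2 * ((r + 1) *+ 2)) = c * D.
  by rewrite sqrtrM ?sqr_ge0 // sqrtr_sqr ger0_norm.
have r1 : 0 <= r + 1 by rewrite addr_ge0.
have P0 := pairing_le hv (leq0n _) tphi r1 phic phi0.
have tphi' := test_function_derive1n 1 tphi.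
have pphi : fun_on X phi by case: tphi.
have r11 : 1 <= r + 1 by rewrite lerDr.
have P1 := pairing_le hv (isT : 1 <= k.+1)%N tphi' r1 dphic (derive1_supp r11 pphi phi0).
rewrite E in P0 P1.
have -> : Sobolev_norm X k.+1 v * (2 * D) * c =
  Sobolev_norm X k.+1 v * (c * D) + Sobolev_norm X k.+1 v * (c * D) by ring.
apply: le_trans (ler_normB _ _) _; apply: lerD; first exact: P0.
exact: P1.
Qed.

(** Cauchy-Schwarz, with L^2 norms at most D sqrt (2 rho) and c sqrt (2 rho). *)
Lemma Rintegral_mul_bounded v phi (D c rho : R) : 0 <= rho ->
  measurable_fun setT v -> (forall x, `|v x| <= D) ->
  (forall x, cell x -> rho < `|x| -> v x = 0) ->
  measurable_fun setT phi -> (forall x, `|phi x| <= c) ->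
  (forall x, cell x -> rho < `|x| -> phi x = 0) ->
  `|\int[mu]_x (v x * phi x)| <= D * c * (rho *+ 2).
Proof.
move=> r0 mv vD v0 mphi phic phi0.
have N1 := bounded_Lnorm2 mv r0 vD v0; have N2 := bounded_Lnorm2 mphi r0 phic phi0.
have L g s : measurable_fun setT g -> ('N[mu]_2%:E[EFin \o g] <= s%:E)%E ->
    g \in Lfun mu 2%:E /\ fine ('N[mu]_2%:E[EFin \o g])%E <= s.
  move=> mg Ns; have lt : ('N[mu]_2%:E[EFin \o g] < +oo)%E.
    by apply: le_lt_trans Ns _; rewrite ltry.
  split; first by rewrite inE; apply/andP; split; rewrite inE.
  by rewrite -lee_fin fineK // ge0_fin_numE ?Lnorm_ge0.
have [l1 n1] := L _ _ mv N1; have [l2 n2] := L _ _ mphi N2.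
have D0 : 0 <= D by apply: le_trans (vD 0).
have c0 : 0 <= c by apply: le_trans (phic 0).
apply: le_trans (Rintegral_mul_le_Lnorm2 l1 l2) _.
apply: le_trans (ler_pM _ _ n1 n2) _; rewrite ?fine_ge0 ?Lnorm_ge0 //.
rewrite (sqrtrM _ (sqr_ge0 D)) (sqrtrM _ (sqr_ge0 c)) !sqrtr_sqr !ger0_norm //.
by rewrite mulrACA -expr2 sqr_sqrtr // mulrn_wge0.
Qed.

Lemma is_derive_difference_quotient g (t0 d : R) :
  (forall e, 0 < e -> \forall t \near t0^', `|(t - t0)^-1 * (g t - g t0) - d| <= e) ->
  is_derive t0 1 g d.
Proof.
move=> H.
suff L : h^-1 *: ((g \o shift t0) (h *: (1 : R)) - g t0) @[h --> 0^'] --> d.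
  by apply: DeriveDef; [apply/cvg_ex; exists d|exact/cvg_lim].
apply/cvgrPdist_le => e /H /nbhs_ballP[s /= s0 hs].
apply/nbhs_ballP; exists s => // h /= hs' h0.
have := hs (h + t0); rewrite /ball /= opprD addrCA subrr addr0 normrN => /(_ _ _).
rewrite distrC addrK /GRing.scale /= mulr1; apply.
  by move: hs'; rewrite /ball /= sub0r normrN.
by rewrite -subr_eq0 addrK.
Qed.

Lemma linear_growth_at0 f : derivable f 0 1 -> f 0 = 0 ->
  exists L d : R, [/\ 0 < L, 0 < d & forall y, `|y| <= d -> `|f y| <= L * `|y|].
Proof.
move=> /cvgrPdist_le/(_ 1 ltr01); set l := lim _ => /nbhs_ballP[d /= d0 hd] f0.
(* The slope exceeds |f'(0)| by the tolerance 1; d is halved because the neighbourhood is an open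
   ball and the claim concerns a closed one. *)
exists (`|l| + 1), (d / 2); split; [by rewrite ltr_wpDl|by rewrite divr_gt0|].
move=> y yd; have [->|y0] := eqVneq y 0; first by rewrite f0 normr0 mulr0.
have := hd y; rewrite /ball /= sub0r normrN => /(_ _ y0).
rewrite addr0 f0 subr0 /GRing.scale /= mulr1 => h.
have {h} : `|l - y^-1 * f y| <= 1 by apply: h; rewrite (le_lt_trans yd) //; lra.
rewrite distrC => h; have : `|y^-1 * f y| <= `|l| + 1.
  have := ler_normD (y^-1 * f y - l) l; rewrite subrK => h2.
  by move: h h2; move: `|_ - _| `|y^-1 * _| => a b; lra.
by rewrite normrM normfV mulrC ler_pdivrMr ?normr_gt0.
Qed.

Lemma ae_eq0_Rintegral_mul v phi n : L1loc X v -> test_function X phi ->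
  (\forall x \ae mu, v x = 0) -> \int[mu]_x (v x * phi^`(n) x) = 0.
Proof.
move=> [_ [mv _ _]] tphi v0.
have mphi : measurable_fun setT phi^`(n).
  have sphi := smooth_derive1n n (test_function_smooth tphi).
  exact: (continuous_measurable_fun (smooth_continuous sphi)).
have mvphi : measurable_fun setT (EFin \o (fun x => v x * phi^`(n) x)).
  by apply/measurable_EFinP; exact: measurable_funM.
rewrite /Rintegral (_ : (\int[mu]_x (v x * phi^`(n) x)%:E = \int[mu]_x (cst 0%E) x)%E).
  by rewrite integral0.
apply: ae_eq_integral => //.
have [N [mN N0 h]] := v0; exists N; split=> // x /= hx.
by apply: h => /= vx; apply: hx => _; rewrite vx mul0r.
Qed.

End Preliminaries.

(** * The weak equation and continuity in time *)

Section Evolution.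
Variables (R : realType) (X : domain).
Local Notation mu := (muX R X).
Local Notation cell := (@cell R X).
Implicit Types (f g v w phi : R -> R) (u ut : R -> R -> R) (T : \bar R).

Lemma test_function_bounded phi : test_function X phi ->
  exists c rho : R, [/\ 0 <= rho, forall x, `|phi x| <= c &
    forall x, cell x -> rho < `|x| -> phi x = 0].
Proof.
move=> tphi; have [K [cK KC K0]] := test_function_supp tphi.
have cphi := smooth_continuous (test_function_smooth tphi).
have [c c0 Kc] := compact_continuous_bounded cK cphi.
have [rho r0 Kr] := compact_continuous_bounded cK (fun x => @cvg_id _ (nbhs x)).
exists c, rho; split => // [x|x cx rx].
  have [|y [cy _] ->] := @fun_on_cell _ X phi x; first by case: tphi.
  have [Ky|Ky] := pselect (K y); first exact: Kc.
  by have := K0 0%N y cy Ky; rewrite derive1n0 => ->; rewrite normr0.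
by apply: (K0 0%N) => // /Kr; rewrite leNgt rx.
Qed.

(** The equation is integrated against [phi] and all derivatives are moved there: the two on [w]
    cost no sign, the one on [g] costs one. It serves with w the time derivative of u and g =
    f(u). *)
Lemma weak_equation w wxx g gx phi :
  weak_derivative X 2 w wxx -> weak_derivative X 1 g gx ->
  (\forall x \ae mu, w x - wxx x + gx x = 0) -> test_function X phi ->
  \int[mu]_x (w x * (phi x - phi^`(2) x)) = \int[mu]_x (g x * phi^`() x).
Proof.
move=> [lw lwxx hw] [lg lgx hg] ae0 tphi.
have [_ ->] := integrable_helmholtz lw tphi.
have l1 := L1loc_lin (-1) lwxx lw.
have l2 := L1loc_lin 1 l1 lgx.
have h0 : \forall x \ae mu, 1 * (-1 * wxx x + w x) + gx x = 0.
  have [N [mN N0 h]] := ae0; exists N; split => // x /= hx; apply: h => /= h1.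
  by apply: hx; rewrite -h1; ring.
have := ae_eq0_Rintegral_mul 0 l2 tphi h0.
rewrite (@Rintegral_mul_lin _ _ _ _ phi _ 0) // (@Rintegral_mul_lin _ _ _ _ phi _ 0) //=.
rewrite hw // -derive1n1 hg // sqrrN expr1n mul1r.
by move=> ?; lra.
Qed.

Lemma near_before T (t0 : R) : 0 < t0 -> before T t0 ->
  \forall t \near t0, before T t.
Proof.
move=> t00 [_]; rewrite /before; case: T => [s| |] //= h.
  near=> t; split; first by apply: ltW; near: t; exact: lt_nbhsr.
  by rewrite lte_fin; near: t; exact: lt_nbhsl.
near=> t; split; first by apply: ltW; near: t; exact: lt_nbhsr.
by rewrite ltry.
Unshelve. all: by end_near. Qed.

(** Pairing with a fixed [phi] is bounded for the Sobolev norm, so the convergence of difference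
    quotients in H^3 passes to it. *)
Lemma is_derive_pairing T u ut phi (t0 : R) :
  Sobolev_derivative X 3 (before T) u ut ->
  (forall t, before T t -> Sobolev X 3 (u t)) -> Sobolev X 3 (ut t0) ->
  0 < t0 -> before T t0 -> test_function X phi ->
  is_derive t0 1 (fun t => \int[mu]_x (u t x * phi x)) (\int[mu]_x (ut t0 x * phi x)).
Proof.
move=> du hu hut t00 bt0 tphi.
have [c [rho [rho0 phic phi0]]] := test_function_bounded tphi.
pose D := Num.sqrt (c ^+ 2 * (rho *+ 2)).
have D0 : 0 <= D by exact: sqrtr_ge0.
apply: is_derive_difference_quotient => e e0.
(* The 1 added to D guards against D = 0. *)
have := du t0 bt0 => /cvgr0_norm_le/(_ (e / (D + 1))) => H.
have {H} H : \forall t \near within (before T) t0^',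
    `|Sobolev_norm X 3 (fun x => (t - t0)^-1 * (u t x - u t0 x) - ut t0 x)| <= e / (D + 1).
  by apply: H; rewrite divr_gt0 //; lra.
have B : \forall t \near t0^', before T t.
  by apply: nbhs_dnbhs; exact: near_before.
rewrite near_withinE in H.
near=> t.
have bt : before T t by near: t.
have Nt : Sobolev_norm X 3
    (fun x => (t - t0)^-1 * (u t x - u t0 x) - ut t0 x) <= e / (D + 1).
  apply: le_trans (ler_norm _) _; move: bt; near: t. exact: H.
have S1 := Sobolev_lin (-1) (hu _ bt0) (hu _ bt).
(* Since -2 w + w = - w, this expresses the subtraction of [ut t0] in the shape a u + v. *)
have S2 := Sobolev_lin (t - t0)^-1 S1 (Sobolev_lin (-2) hut hut).
have E : (fun x => (t - t0)^-1 * (-1 * u t0 x + u t x) + (-2 * ut t0 x + ut t0 x)) =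
    (fun x => (t - t0)^-1 * (u t x - u t0 x) - ut t0 x).
  by apply/funext => x; ring.
have Sw := S2; rewrite E in Sw.
have l0 := Sobolev_L1loc (hu _ bt0); have lt := Sobolev_L1loc (hu _ bt).
have lut := Sobolev_L1loc hut.
have l1 := L1loc_lin (-1) l0 lt; have l2 := L1loc_lin (-2) lut lut.
have E1 := @Rintegral_mul_lin R X _ _ phi (-1) 0 l0 lt tphi.
have E2 := @Rintegral_mul_lin R X _ _ phi (-2) 0 lut lut tphi.
have E3 := @Rintegral_mul_lin R X _ _ phi (t - t0)^-1 0 l1 l2 tphi.
have -> : (t - t0)^-1 * (\int[mu]_x (u t x * phi x) - \int[mu]_x (u t0 x * phi x)) -
    \int[mu]_x (ut t0 x * phi x) =
    \int[mu]_x (((t - t0)^-1 * (u t x - u t0 x) - ut t0 x) * phi x).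
  transitivity (\int[mu]_x (((t - t0)^-1 * (-1 * u t0 x + u t x) +
    (-2 * ut t0 x + ut t0 x)) * phi x)).
    by rewrite !derive1n0 in E1 E2 E3; rewrite E3 E1 E2; ring.
  by apply: eq_Rintegral => x _; ring.
apply: le_trans (pairing_le Sw (leq0n _) tphi rho0 phic phi0) _.
apply: le_trans (ler_wpM2r D0 Nt) _.
rewrite mulrAC ler_pdivrMr; last lra.
by rewrite ler_pM2l //; lra.
Unshelve. all: by end_near. Qed.

(** The differences u t - u t0 vanish beyond the common radius r, so a single embedding constant
    serves for all times. *)
Lemma Sobolev_continuous_uniform T u (r t0 e : R) : 0 <= r ->
  Sobolev_continuous X 4 (before T) u ->
  (forall t, before T t -> continuous (u t)) ->
  (forall t x, before T t -> cell x -> r < `|x| -> u t x = 0) ->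
  before T t0 -> 0 < e ->
  \forall t \near t0, before T t -> forall x, `|u t x - u t0 x| <= e.
Proof.
move=> r0 cu cxu u0 bt0 e0.
have [C C0 HC] := sup_le_Sobolev_norm X r0.
have [_ ct0] := cu t0 bt0.
have := ct0 => /cvgr0_norm_le/(_ (e / C)) => H.
have {H} H : \forall t \near within (before T) (nbhs t0),
    `|Sobolev_norm X 4 (fun x => u t x - u t0 x)| <= e / C.
  by apply: H; rewrite divr_gt0.
rewrite near_withinE in H.
near=> t => bt x.
have Nt : Sobolev_norm X 4 (fun x => u t x - u t0 x) <= e / C.
  apply: le_trans (ler_norm _) _; move: bt; near: t. exact: H.
have S := SobolevB (cu t bt).1 (cu t0 bt0).1.
have cv : continuous (fun x => u t x - u t0 x).
  by move=> y; apply: continuousB; [exact: (cxu t bt)|exact: (cxu t0 bt0)].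
have v0 y : cell y -> r < `|y| -> u t y - u t0 y = 0.
  by move=> cy ry; rewrite !u0 // subrr.
have := HC _ _ S cv v0 x; move=> /le_trans; apply.
by rewrite mulrC -ler_pdivlMr.
Unshelve. all: by end_near. Qed.

End Evolution.

Section BackwardUniqueness.
Variables (R : realType) (X : domain).
Local Notation mu := (muX R X).
Local Notation cell := (@cell R X).
Implicit Types (f g v w phi : R -> R) (u ut : R -> R -> R) (T : \bar R).

Lemma before_le T (s t : R) : before T t -> 0 <= s -> s <= t -> before T s.
Proof. by move=> [_ tT] s0 st; split => //; apply: le_lt_trans tT; rewrite lee_fin. Qed.

Lemma eq0_geometric_bound (y d : R) : (forall n : nat, `|y| <= d / 2 ^+ n) -> y = 0.
Proof.
move=> H; apply/eqP; apply: contraT => y0.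
have ny : 0 < `|y| by rewrite normr_gt0.
have d0 : 0 <= d by have := H 0%N; rewrite expr0 divr1; apply: le_trans.
pose n := Num.bound (d / `|y|).
have h1 : d / `|y| < n%:R by apply: archi_boundP; rewrite divr_ge0.
have h2 : n%:R <= 2 ^+ n :> R by rewrite -natrX ler_nat ltnW // ltn_expl.
have := H n; rewrite ler_pdivlMr ?exprn_gt0 // leNgt => /negP[].
rewrite mulrC -ltr_pdivrMr //; exact: lt_le_trans h2.
Qed.

(** The mean value theorem in time: the derivative of the pairing is the integral of f(u) phi', and
    f 0 = 0 confines f(u) to the support of u. Times start at s > 0 because the equation is imposed
    at positive times only. *)
Lemma solution_pairing_increment f (u0 : R -> R) T u ut (r K s t c : R) phi :
  (forall y, derivable f y 1) -> f 0 = 0 -> solution_with X f u0 T u ut -> 0 <= r ->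
  (forall t x, before T t -> cell x -> r < `|x| -> u t x = 0) ->
  0 < s -> s <= t -> before T t ->
  (forall z x, s <= z <= t -> `|f (u z x)| <= K) ->
  test_function X phi -> (forall x, `|phi x| <= c) -> (forall x, `|phi^`() x| <= c) ->
  (forall x, cell x -> r + 1 < `|x| -> phi x = 0) ->
  `|\int[mu]_x (u t x * (phi x - phi^`(2) x)) -
    \int[mu]_x (u s x * (phi x - phi^`(2) x))| <= K * c * ((r + 1) *+ 2) * (t - s).
Proof.
move=> df f0 [cu cut du cxu [_ eqn]] r0 u0' s0 st bt fK tphi phic dphic phi0.
have bz z : s <= z -> z <= t -> before T z.
  by move=> sz zt; apply: (before_le bt) => //; apply: le_trans sz; exact: ltW.
have S3 z : before T z -> Sobolev X 3 (u z).
  by move=> bz'; apply: SobolevW; exact: (cu z bz').1.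
have tphi2 := test_function_derive1n 2 tphi.
pose G z := \int[mu]_x (u z x * phi x) - \int[mu]_x (u z x * phi^`(2) x).
have GE z : before T z -> \int[mu]_x (u z x * (phi x - phi^`(2) x)) = G z.
  by move=> bz'; have [] := integrable_helmholtz (Sobolev_L1loc (S3 z bz')) tphi.
pose dG z := \int[mu]_x (ut z x * phi x) - \int[mu]_x (ut z x * phi^`(2) x).
have GD z : s <= z -> z <= t -> is_derive z 1 G (dG z).
  move=> sz zt; have bz' := bz z sz zt; have z0 : 0 < z by exact: lt_le_trans sz.
  have A := is_derive_pairing du S3 (cut z bz').1 z0 bz' tphi.
  have B := is_derive_pairing du S3 (cut z bz').1 z0 bz' tphi2.
  exact: (is_deriveB A B).
have dGK z : s <= z -> z <= t -> `|dG z| <= K * c * ((r + 1) *+ 2).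
  move=> sz zt; have bz' := bz z sz zt; have z0 : 0 < z by exact: lt_le_trans sz.
  have [utxx [fx [W2 W1 ae0]]] := eqn z z0 bz'.
  have -> : dG z = \int[mu]_x (f (u z x) * phi^`() x).
    rewrite -(weak_equation W2 W1 ae0 tphi).
    by have [] := integrable_helmholtz (Sobolev_L1loc (cut z bz').1) tphi.
  apply: Rintegral_mul_bounded => //.
  - by rewrite addr_ge0.
  - apply: continuous_measurable_fun => x; apply: continuous_comp; first exact: (cxu z bz').
    by apply: differentiable_continuous; apply/derivable1_diffP.
  - by move=> x; apply: fK; rewrite sz zt.
  - by move=> x cx rx; rewrite (u0' z) //; apply: lt_trans rx; rewrite ltrDl.
  - apply: continuous_measurable_fun; apply: smooth_continuous; apply: smooth_derive1.
    exact: test_function_smooth tphi.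
  - by apply: derive1_supp => //; [rewrite lerDr|case: tphi].
rewrite !GE //; last exact: bz.
have cG : {within `[s, t], continuous G}.
  apply: derivable_within_continuous => z; rewrite in_itv /= => /andP[sz zt].
  by case: (GD z sz zt).
have GD' (z : R) : z \in `]s, t[ -> is_derive z 1 G (dG z).
  by rewrite in_itv /= => /andP[sz zt]; apply: GD; exact: ltW.
have [z] := MVT_segment st GD' cG.
rewrite in_itv /= => /andP[sz zt] ->.
by rewrite normrM ler_pM ?dGK // ger0_norm // subr_ge0.
Qed.

(** Gronwall by iteration: a bound d / 2^n on [t2 - eta, t2] enters the linear bound on f, and the
    duality estimate over a time of at most 1 / (2 M) halves it. *)
Lemma local_backward_uniqueness f (u0 : R -> R) T u ut (r t2 : R) :
  (forall y, derivable f y 1) -> f 0 = 0 -> solution_with X f u0 T u ut -> 0 <= r ->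
  (forall t x, before T t -> cell x -> r < `|x| -> u t x = 0) ->
  before T t2 -> 0 < t2 -> (forall x, u t2 x = 0) ->
  exists eta : R, [/\ 0 < eta, eta < t2 &
    forall s x, t2 - eta <= s <= t2 -> u s x = 0].
Proof.
move=> df f0 sol r0 u0' bt2 t20 ut20.
have [cu cut du cxu _] := sol.
have [L [d [L0 d0 fL]]] := linear_growth_at0 (df 0) f0.
have [C C0 HC] := sup_bound X r0.
have /nbhs_ballP[rho /= rho0 Hrho] := Sobolev_continuous_uniform r0 cu cxu u0' bt2 d0.
pose M := C * (L * ((r + 1) *+ 2)).
have M0 : 0 < M by rewrite !mulr_gt0 // mulrn_wgt0 // ltr_wpDl.
(* [rho] provides the initial bound |u| <= d, [t2] keeps the times positive, and M^-1 together with
   the division by 2 makes M eta at most 1/2. *)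
pose eta := Num.min rho (Num.min t2 M^-1) / 2.
have Mi : 0 < M^-1 by rewrite invr_gt0.
have eta0 : 0 < eta by rewrite divr_gt0 // !lt_min rho0 t20 Mi.
have [eta1 eta2 eta3] : [/\ eta < rho, eta < t2 & eta <= M^-1 / 2].
  move: eta0; rewrite /eta; set m := Num.min _ _ => m0.
  have m1 : m <= rho by rewrite ge_min lexx.
  have m2 : m <= t2 by rewrite /m minCA ge_min lexx.
  have m3 : m <= M^-1 by rewrite !ge_min lexx !orbT.
  by split; lra.
exists eta; split => // s x sx.
apply: (@eq0_geometric_bound _ d) => n.
elim: n s x sx => [|n IH] s x /andP[s1 s2].
  have bs : before T s by apply: (before_le bt2) => //; lra.
  rewrite expr0 divr1 -[u s x]subr0 -(ut20 x); apply: Hrho => //.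
  by rewrite /ball /= ger0_norm; lra.
have s0 : 0 < s by lra.
have bs : before T s by apply: (before_le bt2) => //; exact: ltW.
have dn : d / 2 ^+ n <= d.
  by rewrite ler_pdivrMr ?exprn_gt0 // ler_peMr ?(ltW d0) // exprn_ege1 // ler1n.
pose K := L * (d / 2 ^+ n).
have fK z y : s <= z <= t2 -> `|f (u z y)| <= K.
  move=> /andP[sz zt].
  have h : `|u z y| <= d / 2 ^+ n by apply: IH; rewrite zt (le_trans s1 sz).
  by apply: (le_trans (fL _ (le_trans h dn))); rewrite ler_wpM2l // ltW.
have := HC (u s) (K * ((r + 1) *+ 2) * (t2 - s)) (cxu s bs) _ (fun x => u0' s x bs).
have pus : fun_on X (u s) by exact: (cu s bs).1.1.1.
move=> /(_ pus) H.
have {}H : `|u s x| <= C * (K * ((r + 1) *+ 2) * (t2 - s)).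
  apply: H => phi c tphi phic dphic phi0.
  have := solution_pairing_increment df f0 sol r0 u0' s0 s2 bt2 fK tphi phic dphic phi0.
  rewrite [X in `|X - _|](_ : _ = 0).
    rewrite sub0r normrN => h; apply: (le_trans h).
    by rewrite le_eqVlt; apply/orP; left; apply/eqP; ring.
  transitivity (\int[mu]_y (cst 0 y)).
    by apply: eq_Rintegral => y _; rewrite ut20 mul0r.
  by rewrite /Rintegral integral0.
apply: (le_trans H).
have -> : C * (K * ((r + 1) *+ 2) * (t2 - s)) = M * (t2 - s) * (d / 2 ^+ n).
  by rewrite /M /K; ring.
have -> : d / 2 ^+ n.+1 = 2^-1 * (d / 2 ^+ n) by rewrite exprS invfM; ring.
apply: ler_wpM2r; first by rewrite divr_ge0 ?exprn_ge0 // ltW.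
have : M * (t2 - s) <= M * (M^-1 / 2) by rewrite ler_pM2l //; lra.
have -> // : M * (M^-1 / 2) = 2^-1.
by field; rewrite gt_eqF.
Qed.

End BackwardUniqueness.

Theorem theorem1p2 (R : realType) (X : domain) (f : R -> R)
    (f_diff : forall y : R, derivable f y 1)
    (f_sign : (forall y : R, 0 <= f y) \/ (forall y : R, f y <= 0))
    (f_zero : forall y : R, f y = 0 <-> y = 0)
    (u0 : R -> R) (u0_H4 : Sobolev X 4 u0)
    (T : \bar R) (T_gt0 : (0 < T)%E) (u : R -> R -> R)
    (u_sol : lifespan X f u0 T u)
    (u_supp : compactly_supported X T u) :
  forall t x : R, 0 <= t -> (t%:E < T)%E -> u t x = 0.
Proof.
have f0 : f 0 = 0 by exact/f_zero.
have [[ut sol] _] := u_sol.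
have [cu cut du cxu _] := sol.
have [t0 [r [bt0 r0 ut0 ur]]] := support_bounds T_gt0 u_supp.
(* The infimum of [Z] is the first time after which the solution vanishes; the aim is to show that
   it is 0. *)
pose Z : set R := [set t | before T t /\ forall s x, t < s -> before T s -> u s x = 0].
have Zt0 : Z t0.
  split => // s x ts bs.
  have [|y [cy _] ->] := @fun_on_cell _ X (u s) x; first exact: (cu s bs).1.1.1.
  exact: ut0.
have Z0 t : Z t -> 0 <= t by case=> [[]].
have infZ : has_inf Z by split; [exists t0|exists 0 => t /Z0].
pose t2 := inf Z.
have t20 : 0 <= t2 by apply: lb_le_inf; [exists t0|move=> t /Z0].
have t2Z t : Z t -> t2 <= t by move=> Zt; exact: (ge_inf infZ.2).
have bt2 : before T t2 by apply: (before_le bt0) => //; exact: t2Z.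
have after s x : t2 < s -> before T s -> u s x = 0.
  move=> ts bs; have [t Zt tlt] := inf_lt infZ.1 ts.
  exact: (Zt.2 s x tlt bs).
(* [0, T) is open on the right, so there are times just after t2; the solution vanishes at them and
   is continuous in time for the sup norm. *)
have at2 x : u t2 x = 0.
  have [t1 t21 bt1] : exists2 t1, t2 < t1 & before T t1.
    rewrite /before; case: (T) bt2 => [s| |] [_] //=.
      rewrite lte_fin => ts; exists ((t2 + s) / 2); first lra.
      by rewrite lte_fin; split; lra.
    by move=> _; exists (t2 + 1); [lra|split; [lra|rewrite ltry]].
  apply/eqP; rewrite -normr_le0; apply/ler_addgt0Pl => e e0; rewrite addr0.
  have /nbhs_ballP[d /= d0 hd] := Sobolev_continuous_uniform r0 cu cxu ur bt2 e0.
  pose s := Num.min t1 (t2 + d / 2).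
  have [ts s1 sd] : [/\ t2 < s, s <= t1 & s - t2 < d].
    by rewrite /s /Num.min; case: ifPn => ?; split; lra.
  have bs : before T s by apply: (before_le bt1) => //; lra.
  have := hd s _ bs x; rewrite (after s x ts bs) sub0r normrN; apply.
  by rewrite /ball /= distrC ger0_norm; lra.
have t2E : t2 = 0.
  (* A positive infimum could be lowered by eta, by local backward uniqueness at t2. *)
  apply/eqP; rewrite eq_le t20 andbT leNgt; apply/negP => t2p.
  have [eta [e0 et2 ueta]] := local_backward_uniqueness f_diff f0 sol r0 ur bt2 t2p at2.
  have : Z (t2 - eta).
    split; first by apply: (before_le bt2); lra.
    move=> s x es bs; have [st|ts] := leP s t2; last exact: after.
    by apply: ueta; rewrite st ltW.
  by move=> /t2Z; lra.
(* Time 0 is covered by [at2], all later times by [after]. *)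
move=> t x; rewrite le_eqVlt => /predU1P[<- _|tp tT]; first by have := at2 x; rewrite t2E.
by apply: after; [rewrite t2E|split; [exact: ltW|]].
Qed.
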